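(* Let $k$ be an algebraically closed field of characteristic $p>0$, let $\mathcal O=W(k)$ be its ring of Witt vectors, $K$ the field of fractions of $\mathcal O$, and let $\Lambda$ be an $\mathcal O$-order in a separable $K$-algebra $A=K\otimes_{\mathcal O}\Lambda$. Then for every $n\in\mathbb N$ there are at most finitely many isomorphism classes of rigid $\Lambda$-lattices of $\mathcal O$-rank at most $n$.
   Context: An $\mathcal O$-order in a separable $K$-algebra $A$ is an $\mathcal O$-subalgebra $\Lambda\subseteq A$ that is finitely generated and free as an $\mathcal O$-module and spans the finite-dimensional algebra $A$ over $K$. Modules are right modules. A $\Lambda$-lattice is a $\Lambda$-module that is finitely generated and free over $\mathcal O$. A $\Lambda$-lattice $L$ is called rigid if $\operatorname{Ext}^1_\Lambda(L,L)=0$. *)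

(* Defs.v *)
From HB Require Import structures.
From mathcomp Require Import all_boot all_order all_algebra all_field.
From mathcomp Require Import boolp.
From mathcomp Require Import mpoly.

Set Implicit Arguments.
Unset Strict Implicit.
Unset Printing Implicit Defensive.

Import Order.TTheory GRing.Theory Num.Theory.
Local Open Scope ring_scope.

Section Congruence.
Variable R : comNzRingType.
Implicit Types (x y z : R) (d e : nat).

(* Congruence modulo d R. *)
Definition cgr d x y := exists r, x = y + r *+ d.

Lemma cgr_refl d x : cgr d x x.
Proof. by exists 0; rewrite mul0rn addr0. Qed.

Lemma cgr_sym d x y : cgr d x y -> cgr d y x.
Proof. by case=> r ->; exists (- r); rewrite mulNrn addrK. Qed.

Lemma cgr_trans d x y z : cgr d x y -> cgr d y z -> cgr d x z.
Proof. by case=> r -> [s ->]; exists (s + r); rewrite mulrnDl addrA. Qed.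

Lemma cgrD d x y x' y' : cgr d x x' -> cgr d y y' -> cgr d (x + y) (x' + y').
Proof. by case=> r -> [s ->]; exists (r + s); rewrite mulrnDl addrACA. Qed.

Lemma cgrN d x x' : cgr d x x' -> cgr d (- x) (- x').
Proof. by case=> r ->; exists (- r); rewrite mulNrn opprD. Qed.

Lemma cgrM d x y x' y' : cgr d x x' -> cgr d y y' -> cgr d (x * y) (x' * y').
Proof.
case=> r -> [s ->]; exists (x' * s + r * (y' + s *+ d)).
by rewrite mulrnDl mulrDl mulrDr mulrnAr !mulrnAl addrA.
Qed.

Lemma cgr_sum d n (F G : 'I_n -> R) :
  (forall i, cgr d (F i) (G i)) -> cgr d (\sum_(i < n) F i) (\sum_(i < n) G i).
Proof.
move=> FG; apply: (big_ind2 (cgr d)) => //; first exact: cgr_refl.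
by move=> *; apply: cgrD.
Qed.

Lemma cgrX d x x' n : cgr d x x' -> cgr d (x ^+ n) (x' ^+ n).
Proof.
by move=> xx'; elim: n => [|n IHn]; [exact: cgr_refl | rewrite !exprS; apply: cgrM].
Qed.

Lemma cgr_mulrn d e x y : cgr d x y -> cgr (e * d) (x *+ e) (y *+ e).
Proof. by case=> r ->; exists r; rewrite mulrnDl mulnC mulrnA. Qed.

Lemma cgr_dvd d e x y : (d %| e)%N -> cgr e x y -> cgr d x y.
Proof. by case/dvdnP=> q -> [r ->]; exists (r *+ q); rewrite mulrnA. Qed.

Lemma cgr_exp p m x y : cgr (p ^ m.+1) x y -> cgr (p ^ m.+2) (x ^+ p) (y ^+ p).
Proof.
move=> xy; have [r Dx] := xy.
have [s Ds] : cgr p (\sum_(i < p) x ^+ (p.-1 - i) * y ^+ i) 0.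
  apply: (@cgr_trans _ _ (\sum_(i < p) y ^+ p.-1)); last first.
    by exists (y ^+ p.-1); rewrite sumr_const card_ord add0r.
  apply: cgr_sum => i.
  have {2}-> : p.-1 = (p.-1 - i + i)%N.
    by rewrite subnK // -ltnS (ltn_predK (ltn_ord i)).
  rewrite exprD; apply: cgrM; last exact: cgr_refl.
  by apply: cgrX; apply: cgr_dvd xy; rewrite expnS dvdn_mulr.
exists (r * s); apply/eqP; rewrite -subr_eq0 opprD addrA subrXX.
have -> : x - y = r *+ p ^ m.+1 by rewrite Dx addrC addKr.
rewrite (eq_bigr (fun i : 'I_p => x ^+ (p.-1 - i) * y ^+ i)); last first.
  by move=> i _; rewrite -subn1 -subnDA add1n.
by rewrite Ds add0r mulrnAl mulrnAr -mulrnA -expnS subrr.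
Qed.

Lemma cgr_expn p n x y : cgr p x y -> cgr (p ^ (n.+1)) (x ^+ (p ^ n)) (y ^+ (p ^ n)) .
Proof.
move=> xy; elim: n => [|n IHn]; first by rewrite expn1 !expr1.
have e z : z ^+ (p ^ n.+1) = (z ^+ (p ^ n)) ^+ p by rewrite -exprM -expnSr.
by rewrite !e; apply: cgr_exp.
Qed.

Lemma cgr_dream p x y : prime p -> cgr p ((x + y) ^+ p) (x ^+ p + y ^+ p).
Proof.
move=> p_pr; case: p p_pr => // p p_pr.
rewrite exprDn big_ord_recl big_ord_recr /= subn0 subnn bin0 expr0 mulr1 binn.
rewrite mul1r !mulr1n; set M := \sum_(i < p) _.
have [r ->] : cgr p.+1 M 0.
  have -> : 0 = \sum_(i < p) (0 : R) by rewrite big1.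
  apply: cgr_sum => i; rewrite /bump leq0n add1n.
  have /dvdnP[q ->] : (p.+1 %| 'C(p.+1, i.+1))%N.
    by apply: prime_dvd_bin => //=; rewrite ltnS.
  by eexists; rewrite add0r mulrnA.
by exists r; rewrite add0r (addrC (r *+ _)) addrA.
Qed.
End Congruence.

Section Ghost.
Variable p : nat.

(* The Witt polynomial w_n = \sum_(i <= n) p^i X_i^(p^(n - i)). *)
Definition ghost (R : comNzRingType) (n : nat) (x : nat -> R) : R :=
  \sum_(i < n.+1) x i ^+ (p ^ (n - i)) *+ p ^ i.

Lemma ghost_morph (R S : comNzRingType) (f : {rmorphism R -> S}) n x :
  f (ghost n x) = ghost n (f \o x).
Proof.
by rewrite rmorph_sum; apply: eq_bigr => i _; rewrite rmorphMn rmorphXn.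
Qed.

Lemma ghost_ext (R : comNzRingType) n (x y : nat -> R) :
  (forall i, (i <= n)%N -> x i = y i) -> ghost n x = ghost n y.
Proof. by move=> xy; apply: eq_bigr => i _; rewrite xy // -ltnS. Qed.

Lemma ghostE (R : comNzRingType) n (x : nat -> R) :
  ghost n x = \sum_(i < n) x i ^+ (p ^ (n - i)) *+ p ^ i + x n *+ p ^ n.
Proof. by rewrite /ghost big_ord_recr /= subnn expn0 expr1. Qed.

Hypothesis p_pr : prime p.

Definition torsionfree (R : comNzRingType) :=
  forall (q : R) d, (0 < d)%N -> q *+ d = 0 -> q = 0.

Lemma mpoly_torsionfree m : torsionfree {mpoly int[m]}.
Proof.
move=> q d d_gt0 qd0; apply/mpolyP => u; have /(congr1 (mcoeff u)) := qd0.
rewrite mcoeffMn mcoeff0 => /eqP; rewrite mulrn_eq0 => /orP[/eqP d0|/eqP //].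
by rewrite d0 in d_gt0.
Qed.

Lemma ghost_inj (R : comNzRingType) N (x y : nat -> R) :
  torsionfree R -> (forall i, (i <= N)%N -> ghost i x = ghost i y) ->
  forall i, (i <= N)%N -> x i = y i.
Proof.
move=> tf xy i; elim/ltn_ind: i => i IHi iN; have := xy i iN.
rewrite !ghostE (eq_bigr (fun j : 'I_i => y j ^+ (p ^ (i - j)) *+ p ^ j)).
  move/addrI/eqP; rewrite -subr_eq0 -mulrnBl => /eqP/tf.
  by rewrite expn_gt0 prime_gt0 // => /(_ isT)/eqP; rewrite subr_eq0 => /eqP.
by move=> j _; rewrite IHi // ltnW // (leq_trans _ iN).
Qed.

Section FrobeniusLift.
Variable m : nat.
Local Notation P := {mpoly int[m]}.

Definition frob_lift : P -> P := mmap intr (fun i : 'I_m => 'X_i ^+ p).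
HB.instance Definition _ := GRing.RMorphism.on frob_lift.

Lemma frob_liftP (q : P) : cgr p (frob_lift q) (q ^+ p).
Proof.
pose good (q : P) := cgr p (frob_lift q) (q ^+ p).
have gD a b : good a -> good b -> good (a + b).
  move=> ga gb; rewrite /good rmorphD; apply: cgr_trans (cgrD ga gb) _.
  exact/cgr_sym/cgr_dream.
have g0 : good 0.
  rewrite /good rmorph0 expr0n (gtn_eqF (prime_gt0 p_pr)); exact: cgr_refl.
have g1 : good 1 by rewrite /good rmorph1 expr1n; exact: cgr_refl.
have gM a b : good a -> good b -> good (a * b).
  by move=> ga gb; rewrite /good rmorphM exprMn; apply: cgrM.
have gN a : good a -> good (- a).
  move=> ga; rewrite /good rmorphN; apply: cgr_trans (cgrN ga) _.
  have [r] := cgr_dream a (- a) p_pr.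
  rewrite subrr expr0n (gtn_eqF (prime_gt0 p_pr)) => Dr.
  exists r; apply/eqP; rewrite -subr_eq0 opprD.
  by rewrite addrA -opprD -opprD oppr_eq0 -Dr.
have gX i : good 'X_i.
  by rewrite /good /frob_lift mmapX mmap1U; exact: cgr_refl.
have gn a n : good a -> good (a *+ n).
  by move=> ga; elim: n => [|n IHn]; rewrite ?mulr0n // mulrS; apply: gD.
have gz (c : int) a : good a -> good (c *: a).
  move=> ga; rewrite -[c]intz scaler_int.
  by case: c => n; rewrite ?NegzE ?mulrNz; [|apply: gN]; exact: gn.
elim/mpolyind: q => // c u q _ _ gq; apply: (gD) => //; apply: gz.
rewrite mpolyXE_id; apply: (big_ind good) => // i _.
by elim: (u i) => [|n IHn]; rewrite ?expr0 // exprS; apply: gM.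
Qed.

End FrobeniusLift.

Section Dwork.
Variable P : comNzRingType.
Hypothesis P_tf : torsionfree P.
Variable phi : {rmorphism P -> P}.
Hypothesis phiP : forall q : P, cgr p (phi q) (q ^+ p).

(* The image of the ghost map over a p-torsion free ring with a Frobenius lift
   phi (Dwork's lemma, see dwork_ghost and dwork_lift). *)
Definition dwork (u : nat -> P) :=
  forall n, cgr (p ^ n.+1) (u n.+1) (phi (u n)).

Lemma dwork_step n (x : nat -> P) :
  cgr (p ^ n.+1) (\sum_(i < n.+1) x i ^+ (p ^ (n.+1 - i)) *+ p ^ i)
                 (phi (ghost n x)).
Proof.
rewrite rmorph_sum; apply: cgr_sum => i; rewrite rmorphMn rmorphXn.
have iln : (i <= n)%N by rewrite -ltnS.
have e z : z ^+ (p ^ (n - i).+1) = (z ^+ p) ^+ (p ^ (n - i)) :> P.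
  by rewrite -exprM -expnS.
rewrite (subSn iln) (e (x i)); apply: cgr_sym.
have -> : (p ^ n.+1 = p ^ i * p ^ (n - i).+1)%N.
  by rewrite -expnD addnS subnKC.
by apply: cgr_mulrn; apply: cgr_expn => //; exact: phiP.
Qed.

Lemma dwork_ghost (x : nat -> P) : dwork (fun n => ghost n x).
Proof.
move=> n; rewrite ghostE -[phi _]addr0.
by apply: cgrD; [exact: dwork_step | exists (x n.+1); rewrite add0r].
Qed.

Lemma dwork_lift (u : nat -> P) :
  dwork u -> exists x : nat -> P, forall n, ghost n x = u n.
Proof.
move=> Du.
have lift n : exists x : nat -> P, forall i, (i <= n)%N -> ghost i x = u i.
  elim: n => [|n [x Dx]].
    exists (fun=> u 0%N) => i; rewrite leqn0 => /eqP ->.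
    by rewrite ghostE big_ord0 add0r.
  have := dwork_step n x; rewrite Dx // => /cgr_sym h.
  have [r Dr] := cgr_trans (Du n) h.
  exists (fun i => if i == n.+1 then r else x i) => i.
  rewrite leq_eqVlt ltnS => /orP[/eqP ->|le_in].
    rewrite ghostE eqxx Dr; congr (_ + _); apply: eq_bigr => j _.
    by rewrite ltn_eqF.
  rewrite -Dx //; apply: ghost_ext => j le_ji.
  by rewrite ltn_eqF // ltnS (leq_trans le_ji).
pose s n := sval (cid (lift n)).
have sE n i : (i <= n)%N -> ghost i (s n) = u i by exact: (svalP (cid (lift n))).
exists (fun n => s n n) => n; rewrite -(sE n) //; apply: ghost_ext => i le_in.
apply: (@ghost_inj _ i _ _ P_tf) => // j le_ji.
by rewrite !sE // (leq_trans le_ji).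
Qed.
End Dwork.

End Ghost.

Section WittPoly.
Variable p : nat.
Hypothesis p_pr : prime p.
Local Notation ghost := (ghost p).
Lemma mmap_morph m (R S : comNzRingType) (f : {rmorphism R -> S})
    (h : 'I_m -> R) (q : {mpoly int[m]}) :
  f (mmap intr h q) = mmap intr (f \o h) q.
Proof.
rewrite /mmap rmorph_sum; apply: eq_bigr => u _.
rewrite rmorphM rmorph_int rmorph_prod; congr (_ * _).
by apply: eq_bigr => i _; rewrite rmorphXn.
Qed.

Inductive witt_op := WittAdd | WittSub | WittMul.

Definition ring_op (o : witt_op) (R : comNzRingType) (u v : R) : R :=
  match o with WittAdd => u + v | WittSub => u - v | WittMul => u * v end.

Lemma ring_op_morph o (R S : comNzRingType) (f : {rmorphism R -> S}) u v :
  f (ring_op o u v) = ring_op o (f u) (f v).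
Proof. by case: o; rewrite /= ?rmorphB ?rmorphD ?rmorphM. Qed.

Lemma ghost_transport (P R : comNzRingType) (f : {rmorphism P -> R}) o l
    (s x y : nat -> P) (a b : nat -> R) :
  ghost l s = ring_op o (ghost l x) (ghost l y) ->
  (forall i, (i <= l)%N -> f (x i) = a i) ->
  (forall i, (i <= l)%N -> f (y i) = b i) ->
  ghost l (fun i => f (s i)) = ring_op o (ghost l a) (ghost l b).
Proof.
move=> Ds Da Db; rewrite -[LHS](ghost_morph p f) Ds ring_op_morph !ghost_morph.
by congr ring_op; apply: ghost_ext => i le_il /=; [apply: Da | apply: Db].
Qed.

(* The variables X_0, ..., X_n and Y_0, ..., Y_n; the values at i > n are
   irrelevant. *)
Definition genX n (i : nat) : {mpoly int[n.+1 + n.+1]} := 'X_(lshift n.+1 (inord i)).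
Definition genY n (i : nat) : {mpoly int[n.+1 + n.+1]} := 'X_(rshift n.+1 (inord i)).

Lemma ghost_op_ex (P : comNzRingType) (phi : {rmorphism P -> P})
    (phiP : forall q : P, cgr p (phi q) (q ^+ p)) o (x y : nat -> P) :
  torsionfree P ->
  exists z : nat -> P, forall n, ghost n z = ring_op o (ghost n x) (ghost n y).
Proof.
move=> P_tf; apply: (dwork_lift p_pr P_tf phiP) => n.
have := dwork_ghost phiP x n; have := dwork_ghost phiP y n.
rewrite ring_op_morph; case: o => /= cy cx.
- exact: cgrD.
- by apply: cgrD => //; apply: cgrN.
- exact: cgrM.
Qed.

Lemma witt_poly_ex o m (x y : nat -> {mpoly int[m]}) :
  exists z : nat -> {mpoly int[m]},
    forall n, ghost n z = ring_op o (ghost n x) (ghost n y).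
Proof.
exact: (ghost_op_ex (@frob_liftP _ p_pr m) o x y (@mpoly_torsionfree m)).
Qed.

(* S = witt_seq o n satisfies w_l(S) = w_l(X) o w_l(Y) for all l (witt_seqE), and
   is the only sequence that does (ghost_inj). Its n-th term witt_poly o n is the
   universal polynomial with integral coefficients that gives the n-th coordinate
   of the sum, difference or product of two Witt vectors. *)
Definition witt_seq o n : nat -> {mpoly int[n.+1 + n.+1]} :=
  sval (cid (witt_poly_ex o (genX n) (genY n))).

Definition witt_poly o n := witt_seq o n n.

Definition witt_eval (R : comNzRingType) n (a b : nat -> R) :
    {mpoly int[n.+1 + n.+1]} -> R :=
  mmap intr (fun i => match split i with inl j => a j | inr j => b j end).

HB.instance Definition _ (R : comNzRingType) n (a b : nat -> R) :=
  GRing.RMorphism.on (@witt_eval R n a b).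

Definition witt_bin o (R : comNzRingType) (a b : nat -> R) : nat -> R :=
  fun n => witt_eval a b (witt_poly o n).

Lemma witt_eval_X (R : comNzRingType) n (a b : nat -> R) i :
  (i <= n)%N -> witt_eval a b (genX n i) = a i.
Proof.
by move=> iN; rewrite /witt_eval mmapX mmap1U (unsplitK (inl _)) inordK.
Qed.

Lemma witt_eval_Y (R : comNzRingType) n (a b : nat -> R) i :
  (i <= n)%N -> witt_eval a b (genY n i) = b i.
Proof.
by move=> iN; rewrite /witt_eval mmapX mmap1U (unsplitK (inr _)) inordK.
Qed.

Lemma witt_eval_ext (R : comNzRingType) n (a b a' b' : nat -> R) q :
  (forall i, (i <= n)%N -> a i = a' i) -> (forall i, (i <= n)%N -> b i = b' i) ->
  @witt_eval R n a b q = witt_eval a' b' q.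
Proof.
move=> aa bb; rewrite /witt_eval; congr (mmap _ _ q); apply/funext => i.
by case: (split i) => j; [apply: aa | apply: bb]; rewrite -ltnS.
Qed.

Lemma witt_bin_ext o (R : comNzRingType) (a b a' b' : nat -> R) n :
  (forall i, (i <= n)%N -> a i = a' i) -> (forall i, (i <= n)%N -> b i = b' i) ->
  witt_bin o a b n = witt_bin o a' b' n.
Proof. exact: witt_eval_ext. Qed.

Lemma witt_eval_morph (R S : comNzRingType) (f : {rmorphism R -> S}) n
    (a b : nat -> R) q :
  f (@witt_eval R n a b q) = witt_eval (f \o a) (f \o b) q.
Proof.
rewrite /witt_eval mmap_morph; congr (mmap _ _ q); apply/funext => i /=.
by case: (split i).
Qed.

Lemma witt_bin_morph (R S : comNzRingType) (f : {rmorphism R -> S}) o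
    (a b : nat -> R) n :
  f (witt_bin o a b n) = witt_bin o (f \o a) (f \o b) n.
Proof. exact: witt_eval_morph. Qed.

Lemma witt_seqE o n l :
  ghost l (witt_seq o n) = ring_op o (ghost l (genX n)) (ghost l (genY n)).
Proof. exact: (svalP (cid (witt_poly_ex o (genX n) (genY n)))). Qed.

Lemma ghost_witt_eval o (R : comNzRingType) n (a b : nat -> R) l : (l <= n)%N ->
  ghost l (fun i => witt_eval a b (witt_seq o n i)) =
  ring_op o (ghost l a) (ghost l b).
Proof.
move=> le_ln.
apply: (@ghost_transport _ _ (@witt_eval R n a b) o l (witt_seq o n)
  (genX n) (genY n)) => [|i le_il|i le_il]; first exact: witt_seqE.
- by apply: witt_eval_X; apply: leq_trans le_il le_ln.
- by apply: witt_eval_Y; apply: leq_trans le_il le_ln.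
Qed.

Lemma witt_seq_stable o N n : (n <= N)%N ->
  witt_eval (genX N) (genY N) (witt_poly o n) = witt_seq o N n.
Proof.
move=> le_nN.
have ghE l : (l <= n)%N ->
  ghost l (fun i => witt_eval (genX N) (genY N) (witt_seq o n i)) =
  ghost l (witt_seq o N).
  by move=> le_ln; apply: etrans (ghost_witt_eval o _ _ le_ln) (esym (witt_seqE _ _ _)).
exact: (ghost_inj p_pr (@mpoly_torsionfree (N.+1 + N.+1)) ghE (leqnn n)).
Qed.

Lemma ghost_witt_bin o (R : comNzRingType) n (a b : nat -> R) :
  ghost n (witt_bin o a b) = ring_op o (ghost n a) (ghost n b).
Proof.
rewrite -(@ghost_witt_eval o R n a b n) //; apply: ghost_ext => i le_in.
rewrite -(witt_seq_stable o le_in) /witt_bin.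
rewrite [RHS](witt_eval_morph (@witt_eval R n a b)).
apply: witt_eval_ext => j le_ji /=.
- by apply/esym/witt_eval_X; apply: leq_trans le_ji le_in.
- by apply/esym/witt_eval_Y; apply: leq_trans le_ji le_in.
Qed.

Lemma witt_cover (R : comNzRingType) (a b c : nat -> R) n :
  exists m (f : {rmorphism {mpoly int[m]} -> R}) (x y z : nat -> {mpoly int[m]}),
    forall i, (i <= n)%N -> [/\ a i = f (x i), b i = f (y i) & c i = f (z i)].
Proof.
pose h (i : 'I_(n.+1 + (n.+1 + n.+1))) := match split i with
  | inl j => a j
  | inr j => match split j with inl l => b l | inr l => c l end end.
exists (n.+1 + (n.+1 + n.+1))%N, (mmap intr h).
exists (fun i => 'X_(lshift _ (inord i))).
exists (fun i => 'X_(rshift _ (lshift _ (inord i)))).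
exists (fun i => 'X_(rshift _ (rshift _ (inord i)))).
move=> i le_in; split; rewrite /= mmapX mmap1U /h.
- by rewrite (unsplitK (inl _)) inordK.
- by rewrite (unsplitK (inr _)) (unsplitK (inl _)) inordK.
- by rewrite (unsplitK (inr _)) (unsplitK (inr _)) inordK.
Qed.
End WittPoly.

Section WittTerms.
Variable p : nat.
Hypothesis p_pr : prime p.
Local Notation ghost := (ghost p).
Local Notation witt_bin := (witt_bin p_pr).

Lemma ghost0 (R : comNzRingType) n : ghost n (fun=> 0 : R) = 0.
Proof.
by rewrite /ghost big1 // => i _; rewrite expr0n expn_eq0 gtn_eqF ?mul0rn ?prime_gt0.
Qed.

Lemma ghost1 (R : comNzRingType) n : ghost n (fun i => (i == 0%N)%:R : R) = 1.
Proof.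
rewrite /ghost big_ord_recl /= expr1n big1 ?addr0 // => i _.
by rewrite expr0n expn_eq0 gtn_eqF ?mul0rn ?prime_gt0.
Qed.

(* Identities between terms in +, -, * that hold in all commutative rings hold
   for Witt vectors (witt_identity). *)
Inductive witt_term :=
  | WVar1 | WVar2 | WVar3 | WZero | WOne
  | WOp of witt_op & witt_term & witt_term.

Fixpoint wtermW (R : comNzRingType) (a b c : nat -> R) t : nat -> R :=
  match t with
  | WVar1 => a | WVar2 => b | WVar3 => c
  | WZero => fun=> 0 | WOne => fun i => (i == 0%N)%:R
  | WOp o t1 t2 => witt_bin o (wtermW a b c t1) (wtermW a b c t2)
  end.

Fixpoint wtermR (R : comNzRingType) (u v w : R) t : R :=
  match t with
  | WVar1 => u | WVar2 => v | WVar3 => w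
  | WZero => 0 | WOne => 1
  | WOp o t1 t2 => ring_op o (wtermR u v w t1) (wtermR u v w t2)
  end.

Lemma ghost_wterm (R : comNzRingType) (a b c : nat -> R) t n :
  ghost n (wtermW a b c t) = wtermR (ghost n a) (ghost n b) (ghost n c) t.
Proof.
elim: t => //= [||o t1 <- t2 <-]; [exact: ghost0 | exact: ghost1 |].
exact: ghost_witt_bin.
Qed.

Lemma wterm_morph (R S : comNzRingType) (f : {rmorphism R -> S})
    (a b c : nat -> R) t n :
  f (wtermW a b c t n) = wtermW (f \o a) (f \o b) (f \o c) t n.
Proof.
elim: t n => //= [n|n|o t1 IH1 t2 IH2 n]; [exact: rmorph0 | exact: rmorph_nat |].
rewrite witt_bin_morph; apply: witt_bin_ext => i _ /=; by rewrite (IH1, IH2).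
Qed.

Lemma wterm_ext (R : comNzRingType) (a b c a' b' c' : nat -> R) t n :
  (forall i, (i <= n)%N -> [/\ a i = a' i, b i = b' i & c i = c' i]) ->
  forall i, (i <= n)%N -> wtermW a b c t i = wtermW a' b' c' t i.
Proof.
move=> abc; elim: t => //= [i le_in|i le_in|i le_in|o t1 IH1 t2 IH2 i le_in];
  try by case: (abc i le_in).
by apply: witt_bin_ext => j le_ji; [apply: IH1 | apply: IH2];
  apply: leq_trans le_ji le_in.
Qed.

Lemma witt_identity t1 t2 (R : comNzRingType) (a b c : nat -> R) :
  (forall (S : comNzRingType) (u v w : S), wtermR u v w t1 = wtermR u v w t2) ->
  wtermW a b c t1 = wtermW a b c t2.
Proof.
move=> idt; apply/funext => n.
have [m [f [x [y [z Dabc]]]]] := witt_cover a b c n.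
have eqt t : wtermW a b c t n = f (wtermW x y z t n).
  by apply: etrans (esym (wterm_morph f x y z t n)); apply: wterm_ext Dabc _ _.
have ghE i : (i <= n)%N -> ghost i (wtermW x y z t1) = ghost i (wtermW x y z t2).
  by move=> _; rewrite ghost_wterm idt -ghost_wterm.
rewrite (eqt t1) (eqt t2); congr (f _).
exact: (ghost_inj p_pr (@mpoly_torsionfree m) ghE (leqnn n)).
Qed.
End WittTerms.

(* W(k): sequences of coordinates, in a wrapper that keeps the structures below
   apart from pointwise ones on nat -> k. *)
Record Witt (p : nat) (k : fieldType) (kp : p \in [pchar k]) :=
  MkWitt { witt_coord : nat -> k }.

Section WittRing.
Variables (p : nat) (k : fieldType) (kp : p \in [pchar k]).
Local Notation W := (Witt kp).
Local Notation p_pr := (pcharf_prime kp).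
Implicit Types x y z : W.

HB.instance Definition _ := gen_eqMixin W.
HB.instance Definition _ := gen_choiceMixin W.

Definition witt_zero : W := MkWitt kp (fun=> 0).
Definition witt_one : W := MkWitt kp (fun n => (n == 0%N)%:R).
Definition witt_binop o x y : W :=
  MkWitt kp (witt_bin p_pr o (witt_coord x) (witt_coord y)).

Lemma witt_inj x y : witt_coord x = witt_coord y -> x = y.
Proof. by case: x y => [x] [y] /= ->. Qed.

Definition witt_add := witt_binop WittAdd.
Definition witt_opp := witt_binop WittSub witt_zero.
Definition witt_mul := witt_binop WittMul.

Local Notation V1 := WVar1.
Local Notation V2 := WVar2.
Local Notation V3 := WVar3.
Local Notation "t1 +' t2" := (WOp WittAdd t1 t2) (at level 50).
Local Notation "t1 *' t2" := (WOp WittMul t1 t2) (at level 40).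
Let ident t1 t2 x y z := @witt_identity p p_pr t1 t2 k
  (witt_coord x) (witt_coord y) (witt_coord z).

Lemma witt_addA : associative witt_add.
Proof.
move=> x y z; apply: witt_inj.
by apply: (@ident (V1 +' (V2 +' V3)) (V1 +' V2 +' V3)) => S u v w; apply: addrA.
Qed.

Lemma witt_addC : commutative witt_add.
Proof.
move=> x y; apply: witt_inj.
by apply: (@ident (V1 +' V2) (V2 +' V1) x y x) => S u v w; apply: addrC.
Qed.

Lemma witt_add0 : left_id witt_zero witt_add.
Proof.
move=> x; apply: witt_inj.
by apply: (@ident (WZero +' V1) V1 x x x) => S u v w; apply: add0r.
Qed.

Lemma witt_addN : left_inverse witt_zero witt_opp witt_add.
Proof.
move=> x; apply: witt_inj.
apply: (@ident (WOp WittSub WZero V1 +' V1) WZero x x x) => S u v w /=.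
by rewrite add0r addNr.
Qed.

Lemma witt_mulA : associative witt_mul.
Proof.
move=> x y z; apply: witt_inj.
by apply: (@ident (V1 *' (V2 *' V3)) (V1 *' V2 *' V3)) => S u v w; apply: mulrA.
Qed.

Lemma witt_mulC : commutative witt_mul.
Proof.
move=> x y; apply: witt_inj.
by apply: (@ident (V1 *' V2) (V2 *' V1) x y x) => S u v w; apply: mulrC.
Qed.

Lemma witt_mul1 : left_id witt_one witt_mul.
Proof.
move=> x; apply: witt_inj.
by apply: (@ident (WOne *' V1) V1 x x x) => S u v w; apply: mul1r.
Qed.

Lemma witt_mulDl : left_distributive witt_mul witt_add.
Proof.
move=> x y z; apply: witt_inj.
apply: (@ident ((V1 +' V2) *' V3) ((V1 *' V3) +' (V2 *' V3))) => S u v w.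
exact: mulrDl.
Qed.

HB.instance Definition _ :=
  GRing.isZmodule.Build W witt_addA witt_addC witt_add0 witt_addN.

Lemma witt_one_neq0 : witt_one != 0 :> W.
Proof.
apply/eqP => /(congr1 (fun x : W => witt_coord x 0%N)) /eqP.
by rewrite /= oner_eq0.
Qed.

HB.instance Definition _ := GRing.Zmodule_isComNzRing.Build W
  witt_mulA witt_mulC witt_mul1 witt_mulDl witt_one_neq0.

Definition witt_unit : {pred W} := fun x => `[< exists y : W, y * x = 1 >].

Definition witt_inv x : W :=
  if pselect (exists y : W, y * x = 1) is left e then sval (cid e) else x.

Lemma witt_mulV : {in witt_unit, left_inverse 1 witt_inv *%R}.
Proof.
move=> x /asboolP ux; rewrite /witt_inv; case: pselect => // e.
exact: (svalP (cid e)).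
Qed.

Lemma witt_unitP x y : y * x = 1 -> witt_unit x.
Proof. by move=> yx1; apply/asboolP; exists y. Qed.

Lemma witt_inv_out : {in [predC witt_unit], witt_inv =1 id}.
Proof.
by move=> x /asboolPn nux; rewrite /witt_inv; case: pselect.
Qed.

HB.instance Definition _ := GRing.ComNzRing_hasMulInverse.Build W
  witt_mulV witt_unitP witt_inv_out.
End WittRing.

Section WittDomain.
Variable p : nat.
Hypothesis p_pr : prime p.
Local Notation wghost := (ghost p).

Lemma ghost_low (P : comNzRingType) (x : nat -> P) m n :
  (forall i, (i < m)%N -> x i = 0) -> (n < m)%N -> wghost n x = 0.
Proof.
move=> x0 lt_nm; rewrite -(ghost0 p_pr P n); apply: ghost_ext => i le_in.
by apply: x0; apply: leq_ltn_trans lt_nm.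
Qed.

Lemma ghost_lead (P : comNzRingType) (x : nat -> P) m n :
  (forall i, (i < m)%N -> x i = 0) -> (m <= n)%N ->
  exists2 g, wghost n x = g *+ p ^ m & cgr p g (x m ^+ (p ^ (n - m))).
Proof.
move=> x0 le_mn; rewrite /ghost -(big_mkord xpredT
  (fun i => x i ^+ (p ^ (n - i)) *+ p ^ i)) (big_cat_nat (n := m)) //=; last first.
  exact: leq_trans le_mn _.
rewrite big_nat_cond big1 ?add0r; last first.
  move=> i; rewrite andbT => /andP[_ lt_im].
  by rewrite x0 // expr0n expn_eq0 gtn_eqF ?mul0rn ?prime_gt0.
rewrite big_ltn ?ltnS //; set s := \sum_(_ <= i < _) _.
have [r ->] : cgr (p ^ m.+1) s 0.
  rewrite /s big_nat_cond; apply: (big_ind (fun s => cgr (p ^ m.+1) s 0)).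
  - exact: cgr_refl.
  - by move=> u v u0 v0; rewrite -[0]addr0; apply: cgrD.
  move=> i; rewrite andbT => /andP[lt_mi _]; rewrite -(subnKC lt_mi) expnD.
  by eexists; rewrite add0r mulnC mulrnA.
exists (x m ^+ (p ^ (n - m)) + r *+ p); last by exists r.
by rewrite add0r mulrnDl expnS mulrnA.
Qed.

Lemma witt_mul_lead (P : comNzRingType) (x y z : nat -> P) m l :
  torsionfree P ->
  (forall i, (i < m)%N -> x i = 0) -> (forall i, (i < l)%N -> y i = 0) ->
  (forall n, wghost n z = wghost n x * wghost n y) ->
  cgr p (z (m + l)%N) (x m ^+ (p ^ l) * y l ^+ (p ^ m)).
Proof.
move=> P_tf x0 y0 Dz.
have p_gt0 n : (0 < p ^ n)%N by rewrite expn_gt0 prime_gt0.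
have zE n : (forall i, (i < n)%N -> cgr p (z i) 0) ->
    cgr (p ^ n.+1) (z n *+ p ^ n) (wghost n x * wghost n y).
  move=> z0; rewrite -Dz ghostE -[X in cgr _ X _]add0r.
  apply: cgrD; last exact: cgr_refl.
  apply: cgr_sym; apply: (big_ind (fun u => cgr _ u 0)) => [|u v u0 v0|i _].
  - exact: cgr_refl.
  - by rewrite -[0]addr0; apply: cgrD.
  have [r ->] := z0 i (ltn_ord i).
  rewrite add0r exprMn_n -mulrnA -expnD.
  have le_n : (n.+1 <= p ^ (n - i) + i)%N.
    by rewrite -{1}(subnK (ltnW (ltn_ord i))) -addSn leq_add2r ltn_expl ?prime_gt1.
  rewrite -(subnKC le_n) expnD.
  by eexists; rewrite add0r mulnC mulrnA.
have z_div n g : cgr (p ^ n.+1) (z n *+ p ^ n) (g *+ p ^ n) -> cgr p (z n) g.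
  case=> r Dr; exists r; apply/eqP; rewrite -subr_eq0; apply/eqP.
  apply: (P_tf _ (p ^ n)%N (p_gt0 n)).
  by rewrite mulrnBl mulrnDl -mulrnA -expnS Dr subrr.
have z0 n : (n < m + l)%N -> cgr p (z n) 0.
  elim/ltn_ind: n => n IHn lt_n; apply: z_div.
  apply: cgr_trans (zE n _) _ => [i lt_in|].
    by apply: IHn => //; apply: ltn_trans lt_n.
  rewrite mul0rn; have [lt_nm|le_mn] := ltnP n m.
    by rewrite (ghost_low x0 lt_nm) mul0r; exact: cgr_refl.
  have [lt_nl|le_ln] := ltnP n l.
    by rewrite (ghost_low y0 lt_nl) mulr0; exact: cgr_refl.
  have [g -> _] := ghost_lead x0 le_mn; have [h -> _] := ghost_lead y0 le_ln.
  rewrite mulrnAl mulrnAr -mulrnA -expnD (addnC l) -(subnKC lt_n) expnD.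
  by eexists; rewrite add0r mulnC mulrnA.
apply: z_div; apply: cgr_trans (zE _ z0) _.
have [g -> Dg] := ghost_lead x0 (leq_addr l m).
have [h -> Dh] := ghost_lead y0 (leq_addl m l).
rewrite mulrnAl mulrnAr -mulrnA -expnD (addnC l) expnSr.
apply: cgr_mulrn.
by move: (cgrM Dg Dh); rewrite addKn addnK.
Qed.

End WittDomain.

Section WittIdomain.
Variables (p : nat) (k : fieldType) (kp : p \in [pchar k]).
Local Notation W := (Witt kp).
Local Notation p_pr := (pcharf_prime kp).

Lemma witt_lead (a b : nat -> k) m l :
  (forall i, (i < m)%N -> a i = 0) -> (forall i, (i < l)%N -> b i = 0) ->
  witt_bin p_pr WittMul a b (m + l)%N = a m ^+ (p ^ l) * b l ^+ (p ^ m).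
Proof.
move=> a0 b0.
have [q [f [x [y [w Dxy]]]]] := witt_cover a b a (m + l)%N.
pose x' i := if (i < m)%N then 0 else x i.
pose y' i := if (i < l)%N then 0 else y i.
have fx i : (i <= m + l)%N -> a i = f (x' i).
  move=> le_i; rewrite /x'; case: ifP => [/a0|_]; first by rewrite rmorph0.
  by case: (Dxy i le_i).
have fy i : (i <= m + l)%N -> b i = f (y' i).
  move=> le_i; rewrite /y'; case: ifP => [/b0|_]; first by rewrite rmorph0.
  by case: (Dxy i le_i).
have zE n : ghost p n (witt_bin p_pr WittMul x' y') = ghost p n x' * ghost p n y'.
  exact: (ghost_witt_bin p_pr WittMul n x' y').
have x'0 i : (i < m)%N -> x' i = 0 by rewrite /x' => ->.
have y'0 i : (i < l)%N -> y' i = 0 by rewrite /y' => ->.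
have [r Dr] := witt_mul_lead p_pr (@mpoly_torsionfree q) x'0 y'0 zE.
have -> : witt_bin p_pr WittMul a b (m + l)%N
        = f (witt_bin p_pr WittMul x' y' (m + l)%N).
  by rewrite witt_bin_morph; apply: witt_bin_ext.
rewrite Dr rmorphD rmorphM !rmorphXn rmorphMn mulrn_pchar // addr0.
by rewrite (fx m) ?leq_addr // (fy l) ?leq_addl.
Qed.

Lemma witt_neq0 (x : W) : x != 0 ->
  exists2 m, witt_coord x m != 0 & forall i, (i < m)%N -> witt_coord x i = 0.
Proof.
move=> x_neq0; have ex : exists n, witt_coord x n != 0.
  apply: contrapT => nex; case/eqP: x_neq0; apply: witt_inj; apply/funext => n.
  by apply/eqP; apply: contrapT => xn; apply: nex; exists n; apply/negP.
case: (ex_minnP ex) => m xm min_m; exists m => // i lt_im.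
by apply/eqP; apply: contraLR lt_im => xi; rewrite -leqNgt min_m.
Qed.

Lemma witt_mulf_eq0 (x y : W) : x * y = 0 -> (x == 0) || (y == 0).
Proof.
move=> xy0; apply/norP => -[/witt_neq0[m xm x0] /witt_neq0[l yl y0]].
have /eqP := witt_lead x0 y0.
have -> : witt_bin p_pr WittMul (witt_coord x) (witt_coord y) (m + l)%N
        = witt_coord (x * y) (m + l)%N by [].
by rewrite xy0 eq_sym /= mulf_eq0 !expf_eq0 (negPf xm) (negPf yl) !andbF.
Qed.

HB.instance Definition _ := GRing.ComUnitRing_isIntegral.Build W witt_mulf_eq0.
End WittIdomain.

Section Bases.
Variables (O : pzRingType) (V : zmodType).

(* The O-module structure on V is passed as a bare operation, because the one of
   a lattice is inherited from its structure of module over the order. *)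
Definition free_basis (scal : O -> V -> V) r (e : 'I_r -> V) :=
  forall x : V, exists! c : {ffun 'I_r -> O}, x = \sum_i scal (c i) (e i).
End Bases.

Section SeparableAlgebras.

(* Every right ideal of B is a direct summand. *)
Definition semisimple_algebra (F : fieldType) (B : falgType F) :=
  forall V : {vspace B}, (V * fullv <= V)%VS ->
    exists W : {vspace B},
      [/\ (W * fullv <= W)%VS, (V + W)%VS = fullv & (V :&: W)%VS = 0%VS].

(* The map E (x)_F A -> B sending c (x) a to c *: j a is an isomorphism. *)
Definition scalar_extension (F E : fieldType) (f : {rmorphism F -> E})
    (A : falgType F) (B : falgType E) (j : {rmorphism A -> B}) :=
  (forall c a, j (c *: a) = f c *: j a) /\
  (exists2 e : seq A, basis_of fullv e & basis_of fullv (map j e)).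

(* E (x)_F A is semisimple for every field extension E of F. *)
Definition separable_algebra (F : fieldType) (A : falgType F) :=
  forall (E : fieldType) (f : {rmorphism F -> E})
         (B : falgType E) (j : {rmorphism A -> B}),
    scalar_extension f j -> semisimple_algebra B.
End SeparableAlgebras.

(* The order Lambda is given together with its embedding iota into A. Since it is
   free over O and spans A over K = {fraction O}, A is K (x)_O Lambda. *)
Definition is_order (O : idomainType) (Lambda : algType O)
    (A : falgType {fraction O}) (iota : {rmorphism Lambda -> A}) :=
  [/\ injective iota,
      forall (c : O) (x : Lambda), iota (c *: x) = tofrac c *: iota x,
      exists r (e : 'I_r -> Lambda), free_basis (fun (c : O) x => c *: x) e
    & forall a : A, exists s : seq Lambda, a \in <<map iota s>>%VS].

Section Extensions.
Variable R : pzRingType.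

Definition isomorphic (M N : lmodType R) :=
  exists f : {linear M -> N}, bijective f.

Definition finitely_many_isoclasses (P : lmodType R -> Prop) :=
  exists (N : nat) (X : 'I_N -> lmodType R),
    forall M : lmodType R, P M -> exists i : 'I_N, isomorphic M (X i).

(* Short exact sequences 0 -> N -> ext_mid -> M -> 0. *)
Record extension (M N : lmodType R) := Extension {
  ext_mid : lmodType R;
  ext_in : {linear N -> ext_mid};
  ext_out : {linear ext_mid -> M};
  ext_inj : injective ext_in;
  ext_surj : forall x : M, exists y : ext_mid, ext_out y = x;
  ext_exact : forall y : ext_mid, ext_out y = 0 <-> exists z : N, ext_in z = y
}.

Definition ext_equiv (M N : lmodType R) (E F : extension M N) :=
  exists f : {linear ext_mid E -> ext_mid F},
    (forall z, f (ext_in E z) = ext_in F z) /\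
    (forall y, ext_out F (f y) = ext_out E y).

Section Split.
Variables M N : lmodType R.

Definition split_in (z : N) : (N * M)%type := (z, 0).
Definition split_out (y : (N * M)%type) : M := y.2.

Lemma split_in_linear : linear split_in.
Proof. by move=> c u v; rewrite /split_in; congr (_, _); rewrite /= scaler0 addr0. Qed.

Lemma split_out_linear : linear split_out.
Proof. by []. Qed.

HB.instance Definition _ :=
  GRing.isLinear.Build R N (N * M)%type *:%R split_in split_in_linear.
HB.instance Definition _ :=
  GRing.isLinear.Build R (N * M)%type M *:%R split_out split_out_linear.

Lemma split_in_inj : injective split_in.
Proof. by move=> u v []. Qed.

Lemma split_out_surj x : exists y, split_out y = x.
Proof. by exists (0, x). Qed.

Lemma split_exact y : split_out y = 0 <-> exists z, split_in z = y.
Proof.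
case: y => z x; split=> [/= -> |[u [_ <-]] //]; by exists z.
Qed.

Definition split_extension : extension M N :=
  Extension split_in_inj split_out_surj split_exact.
End Split.

(* Ext^1(M, N) is the group of equivalence classes of extensions of M by N, whose
   zero is the class of the split extension. *)
Definition Ext1_eq0 (M N : lmodType R) :=
  forall E : extension M N, ext_equiv E (split_extension M N).

Definition rigid (M : lmodType R) := Ext1_eq0 M M.
End Extensions.

(* Right Lambda-modules are left modules over the opposite ring Lambda^c, and c in
   O acts on them through c%:A in Lambda. *)
Definition is_lattice_of_rank (O : comNzRingType) (Lambda : algType O)
    (L : lmodType Lambda^c) (r : nat) :=
  exists e : 'I_r -> L,
    free_basis (fun (c : O) (x : L) => ((c%:A : Lambda) : Lambda^c) *: x) e.

(* Main.v *)
(* Write O = W(k), a discrete valuation ring with uniformizer p. Two lattices L, L'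
   of O-rank r are given by families of matrices a, x in M_r(O)^d, and the
   homomorphisms L -> L' form the kernel of the O-linear map N(a, x) sending S to
   (a_l S - S x_l)_l.
   - Rational types: A has finitely many modules of dimension r, being a finite sum
     of minimal right ideals, so K L and K L' may be assumed isomorphic. Then
     N(a, x) and N(a, a) have the same rank over K.
   - Rigidity: if Ext^1(L, L) = 0, every endomorphism of L / p L lifts to L, so
     the ranks of N(a, a) over K and over k agree. Hence, for a rigid, the rank of
     N(a, x) mod p is at most that of N(a, a) mod p, and where equality holds,
     homomorphisms L / p L -> L' / p L' lift to L -> L'.
   - Cramer's rule moves the identity, in the kernel of N(a, a) mod p, to an element
     of the kernel of N(a, x) mod p that is polynomial in x. This gives a polynomial
     H_a on M_r(k)^d with H_a(a) <> 0 such that H_a(x) <> 0 implies that L and L'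
     are isomorphic.
   - H_a(x) is a sum of D products f_t(a) g_t(x) with D independent of a, so the
     matrix (H_a(x)), with a and x running over pairwise non-isomorphic rigid
     lattices of one rational type, is invertible and of rank at most D. *)
From HB Require Import structures.
Require Import Defs.
From mathcomp Require Import all_boot all_order all_algebra all_field.
From mathcomp Require Import boolp mpoly zify.

Set Implicit Arguments.
Unset Strict Implicit.
Unset Printing Implicit Defensive.

Import GRing.Theory.
Local Open Scope ring_scope.

(** * The residue map of Witt vectors, units, and multiplication by p *)

Section WittResidue.
Variables (p : nat) (k : fieldType) (kp : p \in [pchar k]).
Local Notation W := (Witt kp).
Local Notation p_pr := (pcharf_prime kp).

Definition witt_res (x : W) : k := witt_coord x 0%N.

Lemma witt_coord0_bin o (a b : nat -> k) :
  witt_bin p_pr o a b 0%N = ring_op o (a 0%N) (b 0%N).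
Proof.
have g0 (c : nat -> k) : ghost p 0 c = c 0%N.
  by rewrite ghostE big_ord0 add0r mulr1n.
by rewrite -g0 ghost_witt_bin !g0.
Qed.

Fact witt_res_is_zmod_morphism : zmod_morphism witt_res.
Proof.
have resD x y : witt_res (x + y) = witt_res x + witt_res y.
  exact: (witt_coord0_bin WittAdd).
by move=> x y; apply: (canRL (addrK _)); rewrite -resD subrK.
Qed.

Fact witt_res_is_monoid_morphism : monoid_morphism witt_res.
Proof. by split=> // x y; exact: (witt_coord0_bin WittMul). Qed.

HB.instance Definition _ :=
  GRing.isZmodMorphism.Build W k witt_res witt_res_is_zmod_morphism.
HB.instance Definition _ :=
  GRing.isMonoidMorphism.Build W k witt_res witt_res_is_monoid_morphism.

Lemma witt_res_surj c : exists x : W, witt_res x = c.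
Proof. by exists (MkWitt kp (fun=> c)). Qed.

Lemma witt_coordD_eq0 (x y : W) n :
  (forall i, (i <= n)%N -> witt_coord y i = 0) ->
  witt_coord (x + y) n = witt_coord x n.
Proof.
by move=> y0; rewrite -[in RHS](addr0 x); apply: witt_bin_ext.
Qed.

Lemma witt_coordB_eq0 (x y : W) n :
  (forall i, (i <= n)%N -> witt_coord x i = witt_coord y i) ->
  witt_coord (x - y) n = 0.
Proof.
move=> xy; suff -> : witt_coord (x - y) n = witt_coord (x - x) n.
  by rewrite subrr.
apply: (witt_bin_ext p_pr) => // i le_in.
apply: (witt_bin_ext p_pr) => // j le_ji.
by rewrite xy // (leq_trans le_ji).
Qed.

(* The inverse is built one coordinate at a time: a vector u whose coordinates
   vanish below n changes the n-th coordinate of x y by x_0^(p^n) u_n. *)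
Lemma witt_unit_res (x : W) : witt_res x != 0 -> x \is a GRing.unit.
Proof.
move=> x0.
pose good n (y : W) := forall i, (i < n)%N -> witt_coord (1 - x * y) i = 0.
have step n (y : W) : good n y -> exists2 y', good n.+1 y' &
    forall i, (i < n)%N -> witt_coord y' i = witt_coord y i.
  move=> gy; set c := witt_coord (1 - x * y) n.
  pose u := MkWitt kp (fun i => if i == n then c / witt_res x ^+ (p ^ n) else 0).
  have u0 i : (i < n)%N -> witt_coord u i = 0 by move=> lt_in /=; rewrite ltn_eqF.
  have xu_n : witt_coord (x * u) n = c.
    have -> : witt_coord (x * u) n = witt_res x ^+ (p ^ n) * witt_coord u n ^+ (p ^ 0).
      by apply: (@witt_lead _ _ kp _ _ 0 n) => // i; rewrite ltn0.
    by rewrite /= eqxx expn0 expr1 mulrC divfK // expf_neq0.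
  have xu0 i : (i < n)%N -> witt_coord (x * u) i = 0.
    move=> lt_in; have -> : witt_coord (x * u) i = witt_coord (x * 0) i.
      apply: (witt_bin_ext p_pr) => // j le_ji.
      by rewrite u0 // (leq_ltn_trans le_ji).
    by rewrite mulr0.
  exists (y + u) => [i le_in|i lt_in]; last first.
    by apply: witt_coordD_eq0 => j le_ji; rewrite u0 // (leq_ltn_trans le_ji).
  (* 1 - x (y + u) is (1 - x y) - x u, whose two terms agree in all coordinates up to n. *)
  rewrite mulrDr opprD addrA; apply: witt_coordB_eq0 => j le_ji.
  have : (j <= n)%N by rewrite (leq_trans le_ji).
  rewrite leq_eqVlt => /predU1P[->|lt_jn]; first by rewrite xu_n.
  by rewrite gy // xu0.
pose F n (s : {y | good n y}) : {y | good n.+1 y} :=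
  let e := cid2 (step n (sval s) (svalP s)) in exist _ (s2val e) (s2valP e).
have g0 : good 0%N 0 by [].
pose s := fix s n : {y | good n y} :=
  match n with 0 => exist _ 0 g0 | m.+1 => F m (s m) end.
have sS n i : (i < n)%N -> witt_coord (sval (s n.+1)) i = witt_coord (sval (s n)) i.
  exact: (s2valP' (cid2 (step n _ (svalP (s n))))).
(* The limit of the approximations: the i-th coordinate no longer changes from stage i + 1 on. *)
pose y := MkWitt kp (fun i => witt_coord (sval (s i.+1)) i).
have yE n i : (i < n)%N -> witt_coord y i = witt_coord (sval (s n)) i.
  elim: n => // n IHn; rewrite ltnS leq_eqVlt => /predU1P[-> //|lt_in].
  by rewrite IHn // sS.
apply/unitrPr; exists y; apply/esym/eqP; rewrite -subr_eq0; apply/eqP/witt_inj.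
apply/funext => n; rewrite -[RHS](svalP (s n.+1) n (ltnSn n)).
apply: (witt_bin_ext p_pr) => // i le_in.
apply: (witt_bin_ext p_pr) => // j le_ji.
apply: (witt_bin_ext p_pr) => // l le_lj.
by rewrite (yE n.+1) // ltnS (leq_trans le_lj) // (leq_trans le_ji).
Qed.

(** Writing n x as a Witt term allows it to be computed over a polynomial ring, where ghost
    components determine coordinates. *)
Fixpoint mulrn_term n : witt_term :=
  if n is m.+1 then WOp WittAdd WVar1 (mulrn_term m) else WZero.

Lemma mulrn_termR (R : comNzRingType) (u v w : R) n :
  wtermR u v w (mulrn_term n) = u *+ n.
Proof. by elim: n => [|n IHn] //=; rewrite IHn mulrS. Qed.

Lemma mulrn_termW (x : W) n :
  witt_coord (x *+ n) =
  wtermW p_pr (witt_coord x) (witt_coord x) (witt_coord x) (mulrn_term n).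
Proof. by elim: n => [|n IHn] //=; rewrite mulrS -IHn. Qed.

(** Induction on n: lower coordinates congruent modulo p contribute congruent terms modulo p^(n+1),
    so p^(n+1) divides p^n (z_n - z'_n), and p^n cancels. *)
Lemma ghost_cgr (P : comNzRingType) (z z' : nat -> P) :
  torsionfree P ->
  (forall n, cgr (p ^ n.+1) (ghost p n z) (ghost p n z')) ->
  forall n, cgr p (z n) (z' n).
Proof.
move=> P_tf zz' n; elim/ltn_ind: n => n IHn.
have : cgr (p ^ n.+1) (\sum_(i < n) z i ^+ (p ^ (n - i)) *+ p ^ i)
                      (\sum_(i < n) z' i ^+ (p ^ (n - i)) *+ p ^ i).
  apply: cgr_sum => i.
  have -> : (p ^ n.+1 = p ^ i * p ^ (n - i).+1)%N.
    by rewrite -expnD addnS subnKC // ltnW.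
  by apply: cgr_mulrn; apply: cgr_expn; exact: IHn.
move/cgrN; have := zz' n; rewrite !ghostE => h1 h2.
have [r] := cgrD h2 h1; rewrite !addKr => Dr.
exists r; apply/eqP; rewrite -subr_eq0; apply/eqP.
apply: (P_tf _ (p ^ n)%N); first by rewrite expn_gt0 prime_gt0 ?p_pr.
by rewrite mulrnBl mulrnDl -mulrnA -expnS Dr subrr.
Qed.

(* p x = (0, x_0^p, x_1^p, ...): the ghost components of the two sides differ by
   p^(n+1) x_n. *)
Lemma witt_coord_mulp (x : W) n :
  witt_coord (x *+ p) n = if n is m.+1 then witt_coord x m ^+ p else 0.
Proof.
pose VF (R : comNzRingType) (a : nat -> R) n := if n is m.+1 then a m ^+ p else 0.
rewrite mulrn_termW; set a := witt_coord x.
have [m [f [b [c [d Dabc]]]]] := witt_cover a a a n.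
rewrite (@wterm_ext _ p_pr _ a a a (f \o b) (f \o b) (f \o b) _ n) //; last first.
  by move=> i /Dabc[Dai _ _].
rewrite -wterm_morph.
(* A congruence modulo p between polynomials becomes an equality in k, which has characteristic
   p. *)
have [|r ->] := @ghost_cgr _ (wtermW p_pr b b b (mulrn_term p)) (VF _ b)
  (@mpoly_torsionfree m) _ n; last first.
  rewrite rmorphD rmorphMn mulrn_pchar // addr0.
  case: n Dabc => [|n] Dabc /=; first by rewrite rmorph0.
  by rewrite rmorphXn; have [] := Dabc n (leqnSn n) => ->.
move=> l; exists (b l); rewrite ghost_wterm mulrn_termR.
rewrite [ghost p l (VF _ b)]/ghost big_ord_recl /= expr0n expn_eq0.
rewrite (gtn_eqF (prime_gt0 p_pr)) mul0rn add0r.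
rewrite ghostE mulrnDl -mulrnA -expnSr.
congr (_ + _); rewrite -sumrMnl; apply: eq_bigr => i _.
rewrite /bump leq0n add1n -mulrnA -expnSr -exprM -expnS; congr (_ ^+ (p ^ _) *+ _).
by rewrite subnSK.
Qed.

Lemma witt_pchar0 : (p%:R : W) != 0.
Proof.
apply/eqP => /(congr1 (fun x : W => witt_coord x 1%N)).
by rewrite witt_coord_mulp /= expr1n => /eqP; rewrite oner_eq0.
Qed.
End WittResidue.

(** Shifting the coordinates down and taking p-th roots, which exist in k, undoes the formula
    [witt_coord_mulp]. *)
Lemma witt_res_eq0 (p : nat) (k : closedFieldType) (kp : p \in [pchar k])
  (x : Witt kp) : witt_res x = 0 -> exists y, x = y *+ p.
Proof.
move=> x0; have rt (c : k) : exists u, u ^+ p = c.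
  have p_gt0 : (0 < p)%N by rewrite prime_gt0 ?(pcharf_prime kp).
  have /closed_rootP[u] : size ('X^p - c%:P) != 1%N.
    by rewrite size_XnsubC // eqSS -lt0n.
  by rewrite rootE !hornerE subr_eq0 => /eqP <-; exists u.
pose y := MkWitt kp (fun n => sval (cid (rt (witt_coord x n.+1)))).
exists y; apply/witt_inj/funext => n; rewrite witt_coord_mulp.
by case: n => [//|n] /=; case: cid.
Qed.

(** * Generalized inverses and deformation of kernels over a field *)

Lemma rank_factor1 (F : fieldType) m n (A : 'M[F]_(m, n)) :
  exists S T, S *m A *m T = 1%:M :> 'M_(\rank A).
Proof.
have /row_freeP[T rT] := row_base_free A; have /row_fullP[S cS] := col_base_full A.
exists S, T; have : S *m (col_base A *m row_base A) *m T = 1%:M.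
  by rewrite mulmxA cS mul1mx rT.
by rewrite mulmx_base.
Qed.

Lemma ginv_ex (F : fieldType) m n (A : 'M[F]_(m, n)) :
  exists C, A *m C *m A = A /\ C *m A *m C = C.
Proof.
have [P AP] : exists P, A *m P *m A = A by exists (pinvmx A); rewrite mulmxKpV.
have PAP : P *m A *m P *m A = P *m A by rewrite -2!mulmxA (mulmxA A) AP.
(* Replacing P by P A P keeps the first identity and forces the second. *)
by exists (P *m A *m P); split; rewrite !mulmxA; [rewrite AP AP | rewrite PAP PAP].
Qed.

(* A deformation of rank at most rank N0 moves the kernel of N0 along with it:
   1 + (N - N0) C = N C + (1 - N0 C), where 1 - N0 C projects onto ker N0 along
   the image of C. *)
Section KernelDeformation.
Variables (F : fieldType) (m n : nat) (N0 N : 'M[F]_(m, n)) (C : 'M[F]_(n, m)).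
Hypotheses (N0C : N0 *m C *m N0 = N0) (CN0 : C *m N0 *m C = C).
Hypothesis rankN : (\rank N <= \rank N0)%N.
Let B : 'M_m := 1%:M + (N - N0) *m C.
Hypothesis detB : \det B != 0.

Let P : 'M_m := 1%:M - N0 *m C.

Let BE : B = N *m C + P.
Proof. by rewrite /B mulmxBl addrC -addrA; congr (_ + _); rewrite addrC. Qed.

(** The invertible [B] is N C + P, and P N0 = 0 bounds the rank of P by m - rank N0; N C must supply
    the rest. *)
Let rank_NC : (\rank N0 <= \rank (N *m C))%N.
Proof.
have rP : (\rank P <= m - \rank N0)%N.
  by rewrite -mxrank_ker mxrankS //; apply/sub_kermxP; rewrite mulmxBl mul1mx N0C subrr.
have : (m <= \rank (N *m C) + \rank P)%N.
  have rB : \rank B = m by apply: mxrank_unit; rewrite unitmxE unitfE.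
  by rewrite -[leqLHS]rB BE mxrank_add.
move/leq_trans/(_ (leq_add (leqnn _) rP)).
by have := rank_leq_row N0; lia.
Qed.

Lemma rank_deform : (\rank N0 <= \rank N)%N.
Proof. exact: leq_trans rank_NC (mxrankM_maxl _ _). Qed.

Lemma ker_deform (v : 'rV_m) : v *m N0 = 0 -> v *m \adj B *m N = 0.
Proof.
move=> vN0; set y := v *m \adj B.
have yB : y *m B = \det B *: v by rewrite -mulmxA mul_adj_mx mul_mx_scalar.
have CP : C *m P = 0 by rewrite mulmxBr mulmx1 mulmxA CN0 subrr.
have PP : P *m P = P by rewrite {1}/P mulmxBl mul1mx -mulmxA CP mulmx0 subr0.
(* As C P = 0 and P P = P, multiplying y B = det(B) v by P gives y P on the left; on the right v P =
   v because v N0 = 0. *)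
have yP : y *m P = \det B *: v.
  have := congr1 (mulmx^~ P) yB.
  rewrite BE mulmxDr mulmxDl -!mulmxA CP PP !mulmx0 add0r => ->.
  by rewrite -scalemxAl mulmxBr mulmx1 mulmxA vN0 mul0mx subr0.
have yNC : y *m (N *m C) = 0.
  by move: yB; rewrite {1}BE mulmxDr yP => /(canRL (addrK _)); rewrite subrr.
(* This inclusion is an equality, since rank (N C) >= rank N0 >= rank N. *)
have sub : (kermx N <= kermx (N *m C))%MS.
  by apply/sub_kermxP; rewrite mulmxA mulmx_ker mul0mx.
apply/sub_kermxP; apply: (submx_trans (B := kermx (N *m C))); first exact/sub_kermxP.
rewrite -(mxrank_leqif_sup sub) !mxrank_ker eqn_leq.
by rewrite !leq_sub2l ?(leq_trans rankN) ?mxrankM_maxl.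
Qed.
End KernelDeformation.

(** * Ranks and kernels over a local domain, its fraction field and its residue field *)

Section LocalDomain.
Variables (O : idomainType) (k : fieldType) (res : {rmorphism O -> k}).
Hypothesis res_surj : forall c, exists x, res x = c.
Hypothesis res_unit : forall x, res x != 0 -> x \is a GRing.unit.
Local Notation K := {fraction O}.
Local Notation frac := (map_mx (@tofrac O)).
Local Notation red := (map_mx res).

Lemma red_surj m n (A : 'M[k]_(m, n)) : exists B, red B = A.
Proof.
pose s c := sval (cid (res_surj c)).
exists (\matrix_(i, j) s (A i j)); apply/matrixP => i j.
by rewrite !mxE /s; case: cid.
Qed.

Lemma red_unitmx n (A : 'M[O]_n) : red A \in unitmx -> A \in unitmx.
Proof. by rewrite !unitmxE det_map_mx unitfE => /res_unit. Qed.

Lemma frac_inj m n : injective (frac : 'M[O]_(m, n) -> _).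
Proof.
move=> A B /matrixP AB; apply/matrixP => i j; apply/eqP.
by have := AB i j; rewrite !mxE => /eqP; rewrite tofrac_eq.
Qed.

Lemma rank_split m n (M : 'M[O]_(m, n)) :
  exists (S : 'M_(\rank (red M), m)) (T : 'M_(n, \rank (red M))),
    S *m M *m T \in unitmx.
Proof.
have [S [T ST]] := rank_factor1 (red M).
have [S' S'E] := red_surj S; have [T' T'E] := red_surj T.
exists S', T'; apply: red_unitmx.
by rewrite !map_mxM S'E T'E ST unitmx1.
Qed.

Lemma frac_unitmx n (A : 'M[O]_n) : A \in unitmx -> frac A \in unitmx.
Proof.
move=> uA; apply: (proj1 (mulmx1_unit (B := frac (invmx A)) _)).
by rewrite -map_mxM mulmxV // map_mx1.
Qed.

Lemma rank_red_le m n (M : 'M[O]_(m, n)) : (\rank (red M) <= \rank (frac M))%N.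
Proof.
have [S [T /frac_unitmx/mxrank_unit rP]] := rank_split M.
rewrite -[leqLHS]rP !map_mxM; apply: leq_trans (mxrankM_maxl _ _) _.
exact: mxrankM_maxr.
Qed.

(** P = S N T is invertible over O and its size is the rank of N over K, so the rows of S N span
    those of N over K: N = Z S N. Then T P^-1 S is a generalized inverse with entries in O. *)
Lemma ginv_local m n (N : 'M[O]_(m, n)) :
  (\rank (frac N) <= \rank (red N))%N -> exists G, N *m G *m N = N.
Proof.
move=> rN; have [S [T uP]] := rank_split N; set P := S *m N *m T in uP.
exists (T *m invmx P *m S); apply: frac_inj; rewrite !map_mxM.
have rSN : (\rank (frac N) <= \rank (frac S *m frac N))%N.
  apply: leq_trans rN _; have /frac_unitmx/mxrank_unit rP := uP.
  by rewrite -[leqLHS]rP !map_mxM mxrankM_maxl.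
have /submxP[Z ZE] : (frac N <= frac S *m frac N)%MS.
  rewrite -(mxrank_leqif_sup (submxMl _ _)) eqn_leq rSN.
  by rewrite mxrankS // submxMl.
have PV : frac S *m frac N *m frac T *m frac (invmx P) = 1%:M.
  by rewrite -!map_mxM mulmxV // map_mx1.
by rewrite {1}ZE !mulmxA -(mulmxA Z) -(mulmxA Z) -(mulmxA Z) PV mulmx1 -mulmxA -ZE.
Qed.

(** The projection 1 - N G sends any lift of v into the kernel of N, and it does not change the
    residue because v is killed by [red N]. *)
Lemma lift_kernel m n (N : 'M[O]_(m, n)) (v : 'rV[k]_m) :
  (\rank (frac N) <= \rank (red N))%N -> v *m red N = 0 ->
  exists2 y : 'rV_m, y *m N = 0 & red y = v.
Proof.
move=> /ginv_local[G NGN] vN; have [w wv] := red_surj v.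
exists (w - w *m N *m G); first by rewrite mulmxBl -!mulmxA (mulmxA N) NGN subrr.
by rewrite map_mxB !map_mxM wv vN mul0mx subr0.
Qed.

(** Lifts of generators of the kernel over k have at least the same rank over K, so the kernel over
    K is at least as large. *)
Lemma rank_frac_le m n (N : 'M[O]_(m, n)) :
  (forall v : 'rV_m, v *m red N = 0 -> exists2 y : 'rV_m, y *m N = 0 & red y = v) ->
  (\rank (frac N) <= \rank (red N))%N.
Proof.
move=> lift; pose rw i := row i (kermx (red N)).
have rw0 i : rw i *m red N = 0 by rewrite -row_mul mulmx_ker row0.
pose Y := \matrix_i s2val (cid2 (lift _ (rw0 i))).
have YN : Y *m N = 0.
  apply/row_matrixP => i; rewrite row_mul rowK row0.
  exact: (s2valP (cid2 (lift _ (rw0 i)))).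
have Yker : red Y = kermx (red N).
  apply/row_matrixP => i; rewrite -map_row rowK.
  exact: (s2valP' (cid2 (lift _ (rw0 i)))).
have : (\rank (red Y) <= \rank (kermx (frac N)))%N.
  apply: leq_trans (rank_red_le _) _; apply: mxrankS; apply/sub_kermxP.
  by rewrite -map_mxM YN map_mx0.
rewrite Yker !mxrank_ker.
by have := rank_leq_row (frac N); have := rank_leq_row (red N); lia.
Qed.
End LocalDomain.

(** * Functions of two variables of finite rank *)

Section Separated.
Variables (F : fieldType) (C X : Type).

(** A substitute for polynomial dependence: only the finite rank of the matrix (H c x) matters, and
    this is stable under sums and products without tracking degrees or monomials. *)
Definition separated (H : C -> X -> F) :=
  exists (D : finType) (f : C -> D -> F) (g : X -> D -> F),
    forall c x, H c x = \sum_t f c t * g x t.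

Lemma separated_ext H H' :
  (forall c x, H c x = H' c x) -> separated H -> separated H'.
Proof. by move=> HH' [D [f [g fg]]]; exists D, f, g => c x; rewrite -HH'. Qed.

Lemma separatedC (f : C -> F) : separated (fun c _ => f c).
Proof. by exists unit, (fun c _ => f c), (fun _ _ => 1) => c x; rewrite big_const card_unit /= mulr1 addr0. Qed.

Lemma separatedX (g : X -> F) : separated (fun _ x => g x).
Proof. by exists unit, (fun _ _ => 1), (fun x _ => g x) => c x; rewrite big_const card_unit /= mul1r addr0. Qed.

Lemma separatedD H H' :
  separated H -> separated H' -> separated (fun c x => H c x + H' c x).
Proof.
move=> [D [f [g fg]]] [D' [f' [g' fg']]].
exists (D + D')%type, (fun c t => match t with inl u => f c u | inr u => f' c u end),
  (fun x t => match t with inl u => g x u | inr u => g' x u end) => c x.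
by rewrite fg fg' big_sumType.
Qed.

Lemma separatedM H H' :
  separated H -> separated H' -> separated (fun c x => H c x * H' c x).
Proof.
move=> [D [f [g fg]]] [D' [f' [g' fg']]].
exists (D * D')%type, (fun c t => f c t.1 * f' c t.2), (fun x t => g x t.1 * g' x t.2).
move=> c x; rewrite fg fg' big_distrlr pair_bigA.
by apply: eq_bigr => -[t u] _ /=; rewrite mulrACA.
Qed.

Lemma separated_sum (I : Type) (r : seq I) (P : pred I) (H : I -> C -> X -> F) :
  (forall i, separated (H i)) ->
  separated (fun c x => \sum_(i <- r | P i) H i c x).
Proof.
move=> sH; elim: r => [|i r IHr].
  by apply: separated_ext (separatedC (fun=> 0)) => c x; rewrite big_nil.
case Pi: (P i); last by apply: separated_ext IHr => c x; rewrite big_cons Pi.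
by apply: separated_ext (separatedD (sH i) IHr) => c x; rewrite big_cons Pi.
Qed.

Lemma separated_prod (I : Type) (r : seq I) (P : pred I) (H : I -> C -> X -> F) :
  (forall i, separated (H i)) ->
  separated (fun c x => \prod_(i <- r | P i) H i c x).
Proof.
move=> sH; elim: r => [|i r IHr].
  by apply: separated_ext (separatedC (fun=> 1)) => c x; rewrite big_nil.
case Pi: (P i); last by apply: separated_ext IHr => c x; rewrite big_cons Pi.
by apply: separated_ext (separatedM (sH i) IHr) => c x; rewrite big_cons Pi.
Qed.

Lemma separated_det n (A : C -> X -> 'M[F]_n) :
  (forall i j, separated (fun c x => A c x i j)) -> separated (fun c x => \det (A c x)).
Proof.
move=> sA; apply: separated_sum => s; apply: separatedM; first exact: separatedC.
exact: separated_prod.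
Qed.

Lemma separated_adj n (A : C -> X -> 'M[F]_n) i j :
  (forall i j, separated (fun c x => A c x i j)) ->
  separated (fun c x => (\adj (A c x)) i j).
Proof.
move=> sA; apply: (@separated_ext (fun c x => cofactor (A c x) j i)).
  by move=> c x; rewrite mxE.
apply: separatedM; first exact: separatedC.
apply: separated_det => u v.
by apply: separated_ext (sA (lift j u) (lift i v)) => c x; rewrite !mxE.
Qed.

(** The matrix (H (c i) (x j)) is diagonal and invertible, yet factors through dimension #|D|. *)
Lemma separated_bound H : separated H -> exists D : nat,
  forall m (c : 'I_m -> C) (x : 'I_m -> X),
    (forall i, H (c i) (x i) != 0) -> (forall i j, i != j -> H (c i) (x j) = 0) ->
    (m <= D)%N.
Proof.
move=> [D [f [g fg]]]; exists #|D| => m c x Hii Hij.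
pose A := \matrix_(i < m, t < #|D|) f (c i) (enum_val t).
pose B := \matrix_(t < #|D|, j < m) g (x j) (enum_val t).
have -> : m = \rank (diag_mx (\row_i H (c i) (x i))).
  apply/esym/mxrank_unit; rewrite unitmxE unitfE det_diag.
  by apply/prodf_neq0 => i _; rewrite mxE.
have -> : diag_mx (\row_i H (c i) (x i)) = A *m B; last exact: mulmx_max_rank.
apply/matrixP => i j; rewrite !mxE.
have -> : (H (c i) (x i) *+ (i == j)) = H (c i) (x j).
  by case: eqVneq => [->|/Hij ->]; rewrite ?mulr1n ?mulr0n.
rewrite fg (reindex_onto enum_val enum_rank) /=; last by move=> t _; exact: enum_rankK.
by apply: eq_big => t; rewrite ?enum_valK ?eqxx // => _; rewrite !mxE.
Qed.
End Separated.

(** * Spaces of intertwiners and the bound over a field *)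

(* Row vectors of length r * r stand for matrices S through mxvec, and
   intertwine a x is the matrix of S |-> (a_l S - S x_l)_l. *)
Section Intertwiners.
Variables (R : comNzRingType) (d r : nat).
Implicit Types a x : 'I_d -> 'M[R]_r.

Definition left_mulmx a : 'M[R]_(r * r, \sum_(l < d) (r * r)) :=
  \mxrow_(l < d) lin_mulmx (a l).
Definition right_mulmx x : 'M[R]_(r * r, \sum_(l < d) (r * r)) :=
  \mxrow_(l < d) lin_mulmxr (x l).
Definition intertwine a x := left_mulmx a - right_mulmx x.

Lemma intertwineP a x S :
  mxvec S *m intertwine a x = 0 <-> forall l, a l *m S = S *m x l.
Proof.
rewrite mulmxBr !mul_mxrow -mxrowB -(mxrow0 1); split=> [/eq_mxrowP aS l | aS].
  apply/eqP; rewrite -subr_eq0; apply/eqP/(can_inj mxvecK).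
  by have := aS l; rewrite !mul_vec_lin linearB linear0.
apply: eq_mxrow => l; rewrite !mul_vec_lin -linearB /= aS subrr.
exact: linear0.
Qed.
End Intertwiners.

Lemma map_mxrow (R S : Type) (f : R -> S) q (q_ : 'I_q -> nat) m
    (B : forall j, 'M[R]_(m, q_ j)) :
  map_mx f (\mxrow_j B j) = \mxrow_j map_mx f (B j).
Proof. by apply/matrixP => i j; rewrite !mxE. Qed.

Lemma map_intertwine (R S : comNzRingType) (f : {rmorphism R -> S}) d r
    (a x : 'I_d -> 'M[R]_r) :
  map_mx f (intertwine a x) =
  intertwine (fun l => map_mx f (a l)) (fun l => map_mx f (x l)).
Proof.
rewrite map_mxB !map_mxrow.
by congr (_ - _); apply: eq_mxrow => l; apply: map_lin_mx => A; rewrite map_mxM.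
Qed.

Section IntertwinerDeformation.
Variables (F : fieldType) (d r : nat).
Local Notation rep := ('I_d -> 'M[F]_r).

(** The matrix [B] of the kernel deformation from N(a, a) to N(a, x), where c = (a, C) carries a
    generalized inverse C of N(a, a). *)
Let deform (c : rep * 'M_(_, _)) (x : rep) : 'M_(r * r) :=
  1%:M + (intertwine c.1 x - intertwine c.1 c.1) *m c.2.

Let separated_deform i j : separated (fun c x => deform c x i j).
Proof.
have E c x : deform c x i j =
    (i == j)%:R + \sum_q (right_mulmx c.1 i q - right_mulmx x i q) * c.2 q j.
  (* The maps S |-> a_l S cancel in N(a, x) - N(a, a), which leaves an affine expression in x. *)
  have -> : deform c x = 1%:M + (right_mulmx c.1 - right_mulmx x) *m c.2.
    rewrite /deform /intertwine; congr (_ + _ *m _).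
    by rewrite opprB addrC addrA subrK.
  move: (right_mulmx c.1) (right_mulmx x) => U V; rewrite !mxE; congr (_ + _).
  by apply: eq_bigr => q _; rewrite !mxE.
apply: separated_ext (fun c x => esym (E c x)) _; apply: separatedD.
  exact: separatedC.
apply: separated_sum => q; apply: separatedM; last exact: separatedC.
apply: separatedD; first exact: (separatedC _ (fun c => right_mulmx c.1 i q)).
exact: (separatedX _ (fun x => - right_mulmx x i q)).
Qed.

(** Non-isomorphism is assumed only where the ranks agree, because for residues of lattices only
    there will an intertwiner lift to O. *)
Lemma intertwiner_bound : exists D : nat, forall m (x : 'I_m -> rep),
  (forall i j, \rank (intertwine (x i) (x j)) <= \rank (intertwine (x i) (x i)))%N ->
  (forall i j S, i != j ->
     (\rank (intertwine (x i) (x i)) <= \rank (intertwine (x i) (x j)))%N ->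
     S \in unitmx -> ~ forall l, x i l *m S = S *m x j l) ->
  (m <= D)%N.
Proof.
pose S c x : 'M_r := vec_mx (mxvec 1%:M *m \adj (deform c x)).
(* The first factor makes [ker_deform] applicable and the second makes the resulting intertwiner
   invertible; both are 1 at x = c.1. *)
pose H c x := \det (deform c x) * \det (S c x).
have /separated_bound[D maxD] : separated H.
  apply: separatedM; first exact/separated_det/separated_deform.
  apply: separated_det => i j.
  apply: (@separated_ext _ _ _ (fun c x =>
    \sum_q mxvec 1%:M 0 q * (\adj (deform c x)) q (mxvec_index i j))).
    by move=> c x; rewrite !mxE.
  apply: separated_sum => q; apply: separatedM; first exact: separatedC.
  exact/separated_adj/separated_deform.
exists D => m x rk noniso.
have [C gC] := choice (fun i => ginv_ex (intertwine (x i) (x i))).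
apply: (maxD m (fun i => (x i, C i)) x) => [i|i j ij].
  rewrite /H /S /deform subrr mul0mx addr0 adj1 mulmx1 mxvecK !det1 mulr1.
  exact: oner_neq0.
apply/eqP; apply: contraT; rewrite mulf_eq0 negb_or => /andP[dB dS].
have [N0C CN0] := gC i.
case: (noniso i j (S (x i, C i) (x j)) ij).
- exact: (rank_deform N0C (rk i j) dB).
- by rewrite unitmxE unitfE.
apply/intertwineP; rewrite vec_mxK.
apply: (ker_deform N0C CN0 (rk i j) dB); apply/intertwineP => l.
by rewrite mulmx1 mul1mx.
Qed.
End IntertwinerDeformation.

(** Right multiplication by g embeds the kernel of N(a, a) into that of N(a, x). *)
Lemma rank_intertwine_conj (F : fieldType) d r (a x : 'I_d -> 'M[F]_r) g :
  g \in unitmx -> (forall l, a l *m g = g *m x l) ->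
  (\rank (intertwine a x) <= \rank (intertwine a a))%N.
Proof.
move=> ug ag; set N := intertwine a x; set N' := intertwine a a.
pose G : 'M[F]_(r * r) := lin_mulmxr g.
have freeG : row_free G.
  apply/row_freeP; exists (lin_mulmxr (invmx g)).
  apply/row_matrixP => i; rewrite row1 rowE mulmxA.
  rewrite /G -(vec_mxK (delta_mx 0 i)) mul_vec_lin mul_vec_lin /=.
  by rewrite mulmxK.
have : (\rank (kermx N') <= \rank (kermx N))%N.
  rewrite -(mxrankMfree (kermx N') freeG); apply: mxrankS; apply/sub_kermxP.
  apply/row_matrixP => i; rewrite row0 2!row_mul; set v := row i _.
  have : v *m N' = 0 by rewrite -row_mul mulmx_ker row0.
  rewrite -(vec_mxK v) mul_vec_lin => /intertwineP vN; apply/intertwineP => l /=.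
  by rewrite mulmxA vN -!mulmxA ag.
rewrite !mxrank_ker.
by have := rank_leq_row N; have := rank_leq_row N'; lia.
Qed.

(** * The bound for matrix families over a local domain *)

Section LocalReps.
Variables (O : idomainType) (k : fieldType) (res : {rmorphism O -> k}).
Hypothesis res_surj : forall c, exists x, res x = c.
Hypothesis res_unit : forall x, res x != 0 -> x \is a GRing.unit.
Local Notation K := {fraction O}.
Local Notation frac := (map_mx (@tofrac O)).
Local Notation red := (map_mx res).
Variables d r : nat.
Implicit Types a x : 'I_d -> 'M[O]_r.

Definition liftable_endos a := forall S : 'M[k]_r,
  (forall l, red (a l) *m S = S *m red (a l)) ->
  exists2 T, red T = S & forall l, a l *m T = T *m a l.

(** An isomorphism over the fraction field, with denominators cleared. *)
Definition generically_isomorphic a x :=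
  exists2 g : 'M[O]_r, \det g != 0 & forall l, a l *m g = g *m x l.

Lemma rank_intertwine_generic a x : generically_isomorphic a x ->
  (\rank (frac (intertwine a x)) <= \rank (frac (intertwine a a)))%N.
Proof.
move=> [g g0 ag]; rewrite !map_intertwine.
apply: (@rank_intertwine_conj _ _ _ _ _ (frac g)) => [|l].
  by rewrite unitmxE unitfE det_map_mx tofrac_eq0.
by rewrite -!map_mxM ag.
Qed.

Lemma rank_intertwine_liftable a : liftable_endos a ->
  (\rank (frac (intertwine a a)) <= \rank (red (intertwine a a)))%N.
Proof.
move=> la; apply: (rank_frac_le res_surj res_unit) => v.
rewrite -(vec_mxK v) map_intertwine => /intertwineP/la[T Tv aT].
by exists (mxvec T); [exact/intertwineP | rewrite map_mxvec Tv].
Qed.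

Lemma local_rep_bound : exists D : nat, forall m (x : 'I_m -> 'I_d -> 'M[O]_r),
  (forall i, liftable_endos (x i)) ->
  (forall i j, generically_isomorphic (x i) (x j)) ->
  (forall i j g, i != j -> g \in unitmx -> ~ forall l, x i l *m g = g *m x j l) ->
  (m <= D)%N.
Proof.
have [D maxD] := intertwiner_bound k d r; exists D => m x lx gx nx.
pose N i j := intertwine (x i) (x j).
(* The generic isomorphism compares the ranks over K, and liftability passes from K to k on the
   diagonal. *)
have rkK i j : (\rank (frac (N i j)) <= \rank (red (N i i)))%N.
  exact: leq_trans (rank_intertwine_generic (gx i j)) (rank_intertwine_liftable (lx i)).
apply: (maxD m (fun i l => red (x i l))) => [i j|i j S ij]; rewrite -!map_intertwine.
  exact: leq_trans (rank_red_le res_surj res_unit _) (rkK i j).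
move=> /(leq_trans (rkK i j)) rkN uS /intertwineP; rewrite -map_intertwine.
move=> /(lift_kernel res_surj res_unit rkN)[y yN yS].
apply: (nx i j (vec_mx y) ij).
  by apply: (red_unitmx res_unit); rewrite map_vec_mx yS mxvecK.
by apply/intertwineP; rewrite vec_mxK.
Qed.
End LocalReps.

(** * Minimal right ideals of the algebra and denominators in the order *)

Lemma fraction_repr (O : idomainType) (x : {fraction O}) :
  exists2 d, d != 0 & exists n, tofrac d * x = tofrac n.
Proof.
move: x; elim/quotW => x; exists (frac x).2; first exact: denom_ratioP.
exists (frac x).1; unlock FracField.tofrac; rewrite -[LHS]FracField.pi_mul.
apply/eqmodP; rewrite /= FracField.equivfE /FracField.mulf /=.
by rewrite !numden_Ratio ?(oner_neq0, mul1r, mulr1, denom_ratioP) // mulrC.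
Qed.

Section MinimalRightIdeals.
Variables (F : fieldType) (A : falgType F).
Implicit Types S V W : {vspace A}.

Definition right_ideal V := (V * fullv <= V)%VS.

(** Every nonzero element generates S; the zero ideal is allowed. *)
Definition minimal_right_ideal S := right_ideal S /\
  forall u v, u \in S -> u != 0 -> v \in S -> exists a, v = u * a.

Lemma minimal_right_ideal_ex W : right_ideal W -> W != 0%VS ->
  exists S, [/\ minimal_right_ideal S, (S <= W)%VS & S != 0%VS].
Proof.
elim: {W}_.+1 {-2}W (ltnSn (\dim W)) => // n IHn W leWn idW W0.
have [|/existsNP[u /existsNP[v /not_implyP[Wu /not_implyP[u0 /not_implyP[Wv uv]]]]]] :=
  pselect (forall u v, u \in W -> u != 0 -> v \in W -> exists a, v = u * a).
  by move=> minW; exists W.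
(* U = u A misses v, so it is a nonzero right ideal of smaller dimension. *)
pose U := limg (amull u).
have UP w : reflect (exists a, w = u * a) (w \in U).
  apply: (iffP memv_imgP) => [[a _ ->]|[a ->]]; first by rewrite lfunE; exists a.
  by exists a; rewrite ?memvf ?lfunE.
have Uu : u \in U by apply/UP; exists 1; rewrite mulr1.
have UW : (U <= W)%VS.
  by apply/subvP => _ /UP[a ->]; apply: (subvP idW); rewrite memv_mul ?memvf.
have [|||S [minS SU S0]] := IHn U.
- rewrite -ltnS (leq_trans _ leWn) // ltnS ltn_neqAle dimvS // andbT.
  apply/negP => dimU; apply: uv; apply/UP; suff -> : U = W by [].
  by apply/eqP; rewrite eqEdim UW (eqP dimU) leqnn.
- by apply/prodvP => _ b /UP[a ->] _; apply/UP; exists (a * b); rewrite mulrA.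
- by apply: contraNneq u0 => U0; move: Uu; rewrite U0 memv0.
by exists S; split=> //; exact: subv_trans UW.
Qed.

Lemma sum_minimal_right_ideals : semisimple_algebra A ->
  exists s (S : 'I_s -> {vspace A}),
    (forall t, minimal_right_ideal (S t)) /\ (\sum_t S t)%VS = fullv.
Proof.
move=> ssA.
have idS (ss : seq {vspace A}) : (forall S, S \in ss -> minimal_right_ideal S) ->
    right_ideal (\sum_(S <- ss) S)%VS.
  elim: ss => [|S ss IHss] min_ss; first by rewrite /right_ideal big_nil prod0v.
  rewrite /right_ideal big_cons prodvDl addvS //.
    by have [] := min_ss S (mem_head _ _).
  by apply: IHss => S' S'ss; apply: min_ss; rewrite inE S'ss orbT.
suff [ss [min_ss sum_ss]] : exists ss : seq {vspace A},
    (forall S, S \in ss -> minimal_right_ideal S) /\ (\sum_(S <- ss) S)%VS = fullv.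
  exists (size ss), (fun i => nth 0%VS ss i).
  split=> [t|]; first by apply: min_ss; rewrite mem_nth.
  by rewrite -sum_ss (big_nth 0%VS) big_mkord.
(* As long as the sum is proper, a minimal right ideal inside a complement raises its dimension; n =
   dim A + 1 ends the process. *)
suff ext n : exists ss : seq {vspace A}, (forall S, S \in ss -> minimal_right_ideal S) /\
    ((\sum_(S <- ss) S)%VS = fullv \/ n <= \dim (\sum_(S <- ss) S))%N.
  have [ss [min_ss [|lt_ss]]] := ext (\dim {: A}).+1; first by exists ss.
  by have := dimvS (subvf (\sum_(S <- ss) S)); rewrite leqNgt lt_ss.
elim: n => [|n [ss [min_ss sum_ss]]]; first by exists [::]; split=> //; right.
set V := (\sum_(S <- ss) S)%VS in sum_ss.
have [VT|VT] := eqVneq V fullv; first by exists ss; split=> //; left.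
have [W [idW VW dVW]] := ssA V (idS _ min_ss).
have [|S [minS SW S0]] := minimal_right_ideal_ex idW.
  by apply: contraNneq VT => W0; rewrite -VW W0 addv0.
exists (S :: ss); split=> [S'|]; first by rewrite inE => /predU1P[->|/min_ss].
right; rewrite big_cons dimv_disjoint_sum; last first.
  by apply/eqP; rewrite -subv0 -[X in (_ <= X)%VS]dVW capvC; apply: capvS (subvv _) SW.
rewrite -/V -add1n leq_add ?lt0n ?dimv_eq0 //.
by case: sum_ss => // VT'; rewrite VT' eqxx in VT.
Qed.
End MinimalRightIdeals.

Lemma separable_semisimple (F : fieldType) (A : falgType F) :
  separable_algebra A -> semisimple_algebra A.
Proof.
move=> sepA; apply: (sepA F idfun A idfun); split=> //.
by exists (vbasis fullv); rewrite ?map_id vbasisP.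
Qed.

Section Orders.
Variables (O : idomainType) (Lambda : algType O) (A : falgType {fraction O}).
Variable iota : {rmorphism Lambda -> A}.
Hypothesis ord : is_order iota.

Let iotaI : injective iota. Proof. by case: ord. Qed.
Let iotaZ c x : iota (c *: x) = tofrac c *: iota x. Proof. by case: ord. Qed.

Lemma order_denominator a : exists2 c, c != 0 & exists x, tofrac c *: a = iota x.
Proof.
have [_ _ _ /(_ a)[s as_]] := ord.
have -> : a = \sum_(i < size s) coord [tuple of map iota (in_tuple s)] i a *: iota s`_i.
  rewrite [LHS](@coord_span _ _ _ [tuple of map iota (in_tuple s)]) //.
  by apply: eq_bigr => i _; rewrite (nth_map 0).
apply: (big_ind (fun a => exists2 c, c != 0 & exists x, tofrac c *: a = iota x)).
- by exists 1; rewrite ?oner_eq0 //; exists 0; rewrite scaler0 rmorph0.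
- move=> u v [c c0 [x cu]] [c' c'0 [x' c'v]].
  exists (c * c'); first by rewrite mulf_neq0.
  exists (c' *: x + c *: x'); rewrite rmorphM rmorphD !iotaZ -cu -c'v scalerDr.
  by rewrite !scalerA (mulrC (tofrac c')).
move=> i _; have [d d0 [n dn]] := fraction_repr (coord [tuple of map iota (in_tuple s)] i a).
by exists d => //; exists (n *: s`_i); rewrite iotaZ scalerA dn.
Qed.

Lemma order_denominators n (a : 'I_n -> A) :
  exists2 c, c != 0 & exists x : 'I_n -> Lambda, forall i, tofrac c *: a i = iota (x i).
Proof.
have /choice[c cP] i : exists c, c != 0 /\ exists x, tofrac c *: a i = iota x.
  by have [c c0 cx] := order_denominator (a i); exists c.
have /choice[x xP] i : exists x, tofrac (c i) *: a i = iota x by case: (cP i).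
exists (\prod_i c i); first by apply/prodf_neq0 => i _; case: (cP i).
exists (fun i => (\prod_(j | j != i) c j) *: x i) => i.
by rewrite iotaZ -xP scalerA -rmorphM mulrC (bigD1 i).
Qed.

(* The traces on Lambda of the minimal right ideals of A. *)
Lemma order_right_ideals : semisimple_algebra A ->
  exists s (J : 'I_s -> Lambda -> Prop),
  [/\ forall t c x y, J t x -> J t y -> J t (c *: x + y),
      forall t x y, J t x -> J t (x * y),
      forall t x y, J t x -> x != 0 -> J t y ->
        exists2 c, c != 0 & exists z, c *: y = x * z
    & exists2 c, c != 0 & exists2 x : 'I_s -> Lambda,
        (forall t, J t (x t)) & c%:A = \sum_t x t].
Proof.
move=> /sum_minimal_right_ideals[s [S [minS sumS]]].
exists s, (fun t x => iota x \in S t); split.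
- by move=> t c x y Sx Sy; rewrite rmorphD iotaZ memvD ?memvZ.
- move=> t x y Sx; rewrite rmorphM; have [idS _] := minS t.
  by apply: (subvP idS); rewrite memv_mul ?memvf.
- move=> t x y Sx x0 Sy; have [_ /(_ _ _ Sx _ Sy)[|a ya]] := minS t.
    by apply: contraNneq x0 => ix0; apply/eqP/iotaI; rewrite ix0 rmorph0.
  have [c c0 [z caz]] := order_denominator a; exists c => //; exists z.
  by apply: iotaI; rewrite iotaZ ya rmorphM -caz scalerAr.
have /memv_sumP[a Sa aE] : 1 \in (\sum_t S t)%VS by rewrite sumS memvf.
have [c c0 [x xP]] := order_denominators a; exists c => //; exists x.
  by move=> t; rewrite -xP memvZ ?Sa.
apply: iotaI; rewrite iotaZ rmorph1 aE scaler_sumr rmorph_sum.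
by apply: eq_bigr => t _; rewrite xP.
Qed.
End Orders.

(** * Rational types: finitely many combinatorial data that determine K L *)

Section RationalTypes.
Variables (O : idomainType) (Lambda : algType O).

Definition is_rep r (M : Lambda -> 'M[O]_r) :=
  [/\ M 1 = 1%:M, forall x y, M (x * y) = M x *m M y
    & forall c x y, M (c *: x + y) = c *: M x + M y].

Variables (s : nat) (J : 'I_s -> Lambda -> Prop).
Hypotheses (JD : forall t c x y, J t x -> J t y -> J t (c *: x + y))
  (JM : forall t x y, J t x -> J t (x * y))
  (Jmin : forall t x y, J t x -> x != 0 -> J t y ->
     exists2 c, c != 0 & exists z, c *: y = x * z)
  (J1 : exists2 c, c != 0 & exists2 x : 'I_s -> Lambda,
     (forall t, J t (x t)) & c%:A = \sum_t x t).
Variable r : nat.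
Local Notation fam := {ffun 'I_r * 'I_s -> Lambda}.
Implicit Types (T : {set 'I_r * 'I_s}) (f : fam) (M : Lambda -> 'M[O]_r).

(** The direct sum over T, realized inside one type of families common to all T. *)
Definition in_sum T f :=
  forall q, if q \in T then J q.2 (f q) else f q = 0.

(** Since [row i (M x)] is the i-th basis vector acted on by x, the q-th summand enters through the
    basis vector of index [q.1]. *)
Definition sum_map M f : 'rV[O]_r := \sum_q row q.1 (M (f q)).

Definition sum_inj M T := forall f, in_sum T f -> sum_map M f = 0 -> f = 0.

(* T is a set of pairs (i, t) such that the direct sum of the corresponding J t
   embeds in the representation through the i-th basis vectors, and it is
   maximal. The direct sum then has full rank and only depends on T. *)
Definition rational_type M T :=
  sum_inj M T /\ forall T', sum_inj M T' -> (#|T'| <= #|T|)%N.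

Let J0 t : J t 0.
Proof.
have [c _ [x /(_ t) Jx _]] := J1.
by have := JD (-1) Jx Jx; rewrite scaleN1r addNr.
Qed.

Lemma rational_type_ex M : exists T, rational_type M T.
Proof.
pose P T := `[< sum_inj M T >].
have P0 : P set0.
  by apply/asboolP => f f0 _; apply/ffunP => q; have := f0 q; rewrite inE ffunE.
have [T /asboolP injT maxT] := arg_maxnP (fun T => #|T|) P0.
by exists T; split=> // T' /asboolP; exact: maxT.
Qed.

Lemma in_sumD T c f f' : in_sum T f -> in_sum T f' -> in_sum T (c *: f + f').
Proof.
move=> Tf Tf' q; have := Tf q; have := Tf' q; rewrite !ffunE.
by case: ifP => _; [move=> ? ?; exact: JD | move=> -> ->; rewrite scaler0 addr0].
Qed.

Lemma in_sum0 T : in_sum T 0.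
Proof. by move=> q; rewrite ffunE; case: ifP => // _; exact: J0. Qed.

Lemma in_sum_sum T n (c : 'I_n -> O) (F : 'I_n -> fam) :
  (forall i, in_sum T (F i)) -> in_sum T (\sum_i c i *: F i).
Proof.
move=> TF; apply: (big_ind (in_sum T)) => [|f f' Tf Tf'|i _].
- exact: in_sum0.
- by rewrite -[f]scale1r; exact: in_sumD.
by rewrite -[_ *: _]addr0; apply: in_sumD => //; exact: in_sum0.
Qed.

Definition famM f x : fam := [ffun q => f q * x].

Lemma in_sumM T f x : in_sum T f -> in_sum T (famM f x).
Proof.
move=> Tf q; have := Tf q; rewrite ffunE.
by case: ifP => _; [exact: JM | move=> ->; rewrite mul0r].
Qed.

Section OneRep.
Variable M : Lambda -> 'M[O]_r.
Hypothesis repM : is_rep M.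

Lemma rep0 : M 0 = 0.
Proof.
have [_ _ ML] := repM; have := ML (-1) 0 0.
by rewrite scaleN1r oppr0 addr0 scaleN1r addNr.
Qed.

Lemma repD x y : M (x + y) = M x + M y.
Proof. by have [_ _ ML] := repM; rewrite -[x]scale1r ML !scale1r. Qed.

Lemma repZ c x : M (c *: x) = c *: M x.
Proof. by have [_ _ ML] := repM; rewrite -[_ *: _]addr0 ML rep0 addr0. Qed.

Lemma repA c : M c%:A = c%:M.
Proof. by have [M1 _ _] := repM; rewrite repZ M1 scalemx1. Qed.

Lemma rep_sum (I : Type) (l : seq I) (P : pred I) (F : I -> Lambda) :
  M (\sum_(i <- l | P i) F i) = \sum_(i <- l | P i) M (F i).
Proof. exact: (big_morph M repD rep0). Qed.

Lemma sum_mapD c f f' : sum_map M (c *: f + f') = c *: sum_map M f + sum_map M f'.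
Proof.
rewrite /sum_map scaler_sumr -big_split; apply: eq_bigr => q _.
by rewrite !ffunE repD repZ linearD linearZ.
Qed.

Lemma sum_map0 : sum_map M 0 = 0.
Proof. by rewrite /sum_map big1 // => q _; rewrite ffunE rep0 row0. Qed.

Lemma sum_mapZ c f : sum_map M (c *: f) = c *: sum_map M f.
Proof. by rewrite -[c *: f]addr0 sum_mapD sum_map0 addr0. Qed.

Lemma sum_map_sum n (c : 'I_n -> O) (F : 'I_n -> fam) :
  sum_map M (\sum_i c i *: F i) = \sum_i c i *: sum_map M (F i).
Proof.
elim/big_rec2: _ => [|i u f _ <-]; first exact: sum_map0.
by rewrite sum_mapD.
Qed.

Lemma sum_mapM f x : sum_map M (famM f x) = sum_map M f *m M x.
Proof.
have [_ MM _] := repM; rewrite /sum_map mulmx_suml; apply: eq_bigr => q _.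
by rewrite ffunE MM row_mul.
Qed.

Definition single (q : 'I_r * 'I_s) x : fam := [ffun q' => if q' == q then x else 0].

Lemma sum_map_single q x : sum_map M (single q x) = row q.1 (M x).
Proof.
rewrite /sum_map (bigD1 q) //= ffunE eqxx big1 ?addr0 // => q' q'q.
by rewrite ffunE (negPf q'q) rep0 row0.
Qed.

(** Membership in the K-span of the image of the sum over T, expressed over O. *)
Definition torsion_image T (v : 'rV[O]_r) :=
  exists2 c, c != 0 & exists2 f, in_sum T f & sum_map M f = c *: v.

Lemma torsion_imageD T a u v :
  torsion_image T u -> torsion_image T v -> torsion_image T (a *: u + v).
Proof.
move=> [c c0 [f Tf fu]] [c' c'0 [f' Tf' fv]].
exists (c * c'); first by rewrite mulf_neq0.
exists ((a * c') *: f + c *: f').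
  by apply: in_sumD => //; rewrite -[_ *: _]addr0; apply: in_sumD => //; exact: in_sum0.
rewrite sum_mapD sum_mapZ fu fv scalerDr !scalerA.
by congr (_ *: _ + _ *: _); rewrite mulrC (mulrC a) mulrA.
Qed.

Lemma torsion_image0 T : torsion_image T 0.
Proof.
by exists 1; rewrite ?oner_eq0 //; exists 0; [exact: in_sum0 | rewrite sum_map0 scaler0].
Qed.

Lemma torsion_imageZ T c v : c != 0 -> torsion_image T (c *: v) -> torsion_image T v.
Proof.
move=> c0 [c' c'0 [f Tf fv]]; exists (c' * c); first by rewrite mulf_neq0.
by exists f => //; rewrite fv scalerA.
Qed.

Lemma torsion_image_sum T (I : finType) (c : I -> O) (v : I -> 'rV[O]_r) :
  (forall i, torsion_image T (v i)) -> torsion_image T (\sum_i c i *: v i).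
Proof.
move=> Tv; elim/big_rec: _ => [|i u _ Tu]; first exact: torsion_image0.
exact: torsion_imageD.
Qed.

(* If J q.2 did not meet the image of the sum over T, then q could be added to T;
   if it meets it, it is contained in it up to torsion by minimality. *)
Lemma torsion_image_row T q x : rational_type M T ->
  J q.2 x -> torsion_image T (row q.1 (M x)).
Proof.
move=> [injT maxT] Jx; have [qT|qT] := boolP (q \in T).
  exists 1; rewrite ?oner_eq0 //; exists (single q x).
    move=> q'; rewrite ffunE; case: eqP => [->|_]; first by rewrite qT.
    by case: ifP => // _; exact: J0.
  by rewrite sum_map_single scale1r.
have : ~ sum_inj M (q |: T).
  by move=> /maxT; rewrite cardsU1 qT add1n ltnn.
move=> /existsNP[f /not_implyP[Tf /not_implyP[Mf f0]]].
pose f' := f - single q (f q).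
have Tf' : in_sum T f'.
  move=> q'; have := Tf q'; rewrite !inE !ffunE; case: eqP => [->|_] /=.
    by rewrite (negPf qT) subrr.
  by rewrite subr0.
have Jfq : J q.2 (f q) by have := Tf q; rewrite setU11.
have Mf' : sum_map M f' = - row q.1 (M (f q)).
  rewrite /f' -scaleN1r addrC sum_mapD Mf addr0 sum_map_single.
  by rewrite scaleN1r.
have [fq0|fq0] := eqVneq (f q) 0.
  have f'0 : f' = 0 by apply: injT; rewrite // Mf' fq0 rep0 row0 oppr0.
  case: f0; apply/ffunP => q'; have := congr1 (fun h : fam => h q') f'0.
  by rewrite !ffunE; case: eqP => [->|_]; rewrite ?fq0 ?subr0.
have [_ MM _] := repM; have [c c0 [z cz]] := Jmin Jfq fq0 Jx.
exists c => //; exists (-1 *: famM f' z).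
  by rewrite -[_ *: _]addr0; apply: in_sumD; [exact: in_sumM | exact: in_sum0].
rewrite sum_mapZ sum_mapM Mf' scaleN1r mulNmx opprK -row_mul -MM -cz repZ.
by rewrite linearZ.
Qed.

(** By [J1], c e_i is the sum of the e_i x_t with x_t in [J t], and each of these falls under
    [torsion_image_row]. *)
Lemma torsion_image_full T v : rational_type M T -> torsion_image T v.
Proof.
move=> typT; have [c c0 [x Jx cx]] := J1; apply: (torsion_imageZ c0).
have -> : c *: v = \sum_i v 0 i *: \sum_t 1 *: row i (M (x t)).
  rewrite {1}(row_sum_delta v) scaler_sumr; apply: eq_bigr => i _.
  rewrite scalerA mulrC -scalerA; congr (_ *: _).
  rewrite (eq_bigr (fun t => row i (M (x t)))) => [|t _]; last by rewrite scale1r.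
  rewrite -linear_sum -rep_sum -cx repA.
  by rewrite -scalemx1 linearZ /= row1.
apply: torsion_image_sum => i; apply: torsion_image_sum => t.
exact: (@torsion_image_row T (i, t)).
Qed.
End OneRep.

(** Both lattices contain the same direct sum with full rank. If the family f_i maps to c e_i in the
    first, sending e_i to the image of f_i in the second is c times an isomorphism over K. *)
Lemma rational_type_generic M M' T : is_rep M -> is_rep M' ->
  rational_type M T -> rational_type M' T ->
  exists2 g : 'M[O]_r, \det g != 0 & forall x, M x *m g = g *m M' x.
Proof.
move=> repM repM' typM typM'; have [injM _] := typM; have [injM' _] := typM'.
have [c c0 /choice[f fP]] : exists2 c, c != 0 & forall i : 'I_r, exists f,
    in_sum T f /\ sum_map M f = c *: delta_mx 0 i.
  have /choice[c cP] i : exists c, c != 0 /\ exists2 f, in_sum T f &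
      sum_map M f = c *: delta_mx 0 i.
    by have [c c0 cf] := torsion_image_full repM (delta_mx 0 i) typM; exists c.
  exists (\prod_i c i); first by apply/prodf_neq0 => i _; case: (cP i).
  move=> i; have [_ [f Tf fi]] := cP i.
  exists ((\prod_(j | j != i) c j) *: f); split.
    by rewrite -[_ *: _]addr0; apply: in_sumD => //; exact: in_sum0.
  by rewrite sum_mapZ // fi scalerA mulrC [in RHS](bigD1 i).
have Tf i : in_sum T (f i) by case: (fP i).
have Mf i : sum_map M (f i) = c *: delta_mx 0 i by case: (fP i).
have Mc (v : 'I_r -> O) : sum_map M (\sum_i v i *: f i) = c *: \row_i v i.
  rewrite sum_map_sum // (row_sum_delta (\row_i v i)) scaler_sumr; apply: eq_bigr => i _.
  by rewrite Mf mxE !scalerA mulrC.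
pose g := \matrix_i sum_map M' (f i).
have gE (v : 'rV_r) : v *m g = sum_map M' (\sum_i v 0 i *: f i).
  by rewrite sum_map_sum // mulmx_sum_row; apply: eq_bigr => i _; rewrite rowK.
exists g.
  apply/negP => /det0P[v v0]; rewrite gE => /(injM' _ (in_sum_sum _ Tf)) vf.
  have := Mc (v 0); rewrite vf sum_map0 // => /esym/eqP.
  rewrite scalemx_eq0 (negPf c0) /= => /eqP v00; case/eqP: v0.
  by rewrite -[RHS]v00; apply/rowP => i; rewrite mxE.
move=> x; apply/row_matrixP => i; rewrite !row_mul gE rowK -sum_mapM //.
(* The families f_i x and \sum_j M(x)_ij f_j have the same image under [sum_map M], so they
   coincide. *)
congr (sum_map M' _); apply/eqP; rewrite -subr_eq0; apply/eqP/injM.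
  rewrite -scaleN1r addrC; apply: in_sumD; first exact: in_sumM.
  exact: in_sum_sum.
rewrite -scaleN1r addrC sum_mapD // sum_mapM // Mf Mc.
rewrite -scalemxAl -rowE scaleN1r addrC; apply/eqP; rewrite subr_eq0; apply/eqP.
by congr (_ *: _); apply/rowP => j; rewrite !mxE.
Qed.
End RationalTypes.

(** * Finiteness of sets of isomorphism classes *)

Section FiniteIsoclasses.
Variable R : pzRingType.
Implicit Types (P : lmodType R -> Prop) (L M : lmodType R).

Lemma isomorphic_sym L M : isomorphic L M -> isomorphic M L.
Proof.
move=> [f [g fK gK]]; have ling : linear g := can2_linear fK gK.
by exists (HB.pack_for {linear M -> L} g (GRing.isLinear.Build R M L *:%R g ling)), f.
Qed.

Lemma finitely_many_bounded P :
  (exists D : nat, forall m (X : 'I_m -> lmodType R), (forall i, P (X i)) ->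
     (forall i j, i != j -> ~ isomorphic (X i) (X j)) -> (m <= D)%N) ->
  finitely_many_isoclasses P.
Proof.
move=> [D maxD].
pose good m := `[< exists X : 'I_m -> lmodType R, (forall i, P (X i)) /\
  forall i j, i != j -> ~ isomorphic (X i) (X j) >].
have good0 : exists m, good m.
  by exists 0%N; apply/asboolP; exists (fun=> R^o); split=> [] [].
have goodD m : good m -> (m <= D)%N by move=> /asboolP[X [PX nX]]; exact: maxD PX nX.
case: (ex_maxnP good0 goodD) => m /asboolP[X [PX nX]] max_m.
(* A module isomorphic to no member of a maximal family could be added to it. *)
exists m, X => L PL; apply: contrapT => /forallNP nL.
suff /max_m : good m.+1 by rewrite ltnn.
apply/asboolP; exists (fun i => if unlift ord0 i is Some j then X j else L).
split=> [i|i j]; first by case: unliftP.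
case: (unliftP ord0 i) => [i' ->|->]; case: (unliftP ord0 j) => [j' ->|->].
- by rewrite (inj_eq lift_inj) => /nX.
- by move=> _ /isomorphic_sym /nL.
- by move=> _ /nL.
by rewrite eqxx.
Qed.

Lemma finitely_many_cover (D : finType) (Q : D -> lmodType R -> Prop) P :
  (forall c, finitely_many_isoclasses (Q c)) ->
  (forall L, P L -> exists c, Q c L) -> finitely_many_isoclasses P.
Proof.
move=> /choice[N finQ] PQ; pose X c := sval (cid (finQ c)).
have XP c : forall L, Q c L -> exists i, isomorphic L (X c i) := svalP (cid (finQ c)).
pose I := {c : D & 'I_(N c)}.
exists #|{: I}|, (fun i => X (tag (enum_val i)) (tagged (enum_val i))) => L /PQ[c /XP[i Li]].
by exists (enum_rank (Tagged (fun c => 'I_(N c)) i : I)); rewrite enum_rankK.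
Qed.
End FiniteIsoclasses.

(** * Rigidity and the lifting of endomorphisms modulo p *)

Section ApproximateEndomorphisms.
Variables (R : pzRingType) (L : lmodType R) (p : nat).

(** A linear map L -> L / p L, encoded by a set-theoretic lift L -> L. *)
Record approx_end := ApproxEnd {
  approx_fun : L -> L;
  _ : forall a x y, exists z,
    approx_fun (a *: x + y) = a *: approx_fun x + approx_fun y + z *+ p
}.

Variable S : approx_end.
Local Notation s := (approx_fun S).

Lemma approx_endP a x y : exists z, s (a *: x + y) = a *: s x + s y + z *+ p.
Proof. by case: S. Qed.

Lemma approx_end0 : exists z, s 0 = z *+ p.
Proof.
have [z] := approx_endP (-1) 0 0; rewrite scaler0 addr0 scaleN1r addNr add0r.
by move=> ->; exists z.
Qed.

Definition approx_graph : {pred L * L} :=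
  fun y => `[< exists z, y.1 = s y.2 + z *+ p >].

Fact approx_graph_submod : submod_closed approx_graph.
Proof.
split=> [|a u v /asboolP[z uz] /asboolP[z' vz']]; apply/asboolP.
  by have [z ->] := approx_end0; exists (- z); rewrite mulNrn subrr.
have [w sw] := approx_endP a u.2 v.2; exists (a *: z + z' - w).
rewrite /= uz vz' sw mulrnBl mulrnDl scalerDr scalerMnr.
rewrite -!addrA; congr (_ + _); rewrite [LHS]addrCA; congr (_ + _).
by rewrite (addrA _ (z' *+ p)) subrKC.
Qed.
HB.instance Definition _ :=
  GRing.isSubmodClosed.Build R (L * L)%type approx_graph approx_graph_submod.

Record graph_mod := GraphMod { graph_val : L * L; _ : graph_val \in approx_graph }.
HB.instance Definition _ := [isSub for graph_val].
HB.instance Definition _ := [Choice of graph_mod by <:].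
HB.instance Definition _ := [SubChoice_isSubLmodule of graph_mod by <:].

(* The pullback along s mod p : L -> L / p L of the extension of L / p L by L. *)
Definition graph_in_pair (z : L) : L * L := (z *+ p, 0).

Fact graph_in_subproof z : graph_in_pair z \in approx_graph.
Proof.
apply/asboolP; have [w w0] := approx_end0; exists (z - w).
by rewrite /= w0 -mulrnDl (addrC w) subrK.
Qed.
Definition graph_in z := GraphMod (graph_in_subproof z).
Definition graph_out (y : graph_mod) : L := (val y).2.

Fact graph_in_linear : linear graph_in.
Proof.
move=> a x y; apply: val_inj; rewrite linearD linearZ /= /graph_in_pair.
by rewrite mulrnDl scalerMnr; congr (_, _); rewrite /= scaler0 addr0.
Qed.
HB.instance Definition _ := GRing.isLinear.Build R L graph_mod *:%R graph_in graph_in_linear.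

Fact graph_out_linear : linear graph_out.
Proof. by move=> a x y; rewrite /graph_out linearD linearZ. Qed.
HB.instance Definition _ := GRing.isLinear.Build R graph_mod L *:%R graph_out graph_out_linear.

Hypothesis L_tf : forall x : L, x *+ p = 0 -> x = 0.

Fact graph_in_inj : injective graph_in.
Proof.
by move=> x y [/eqP]; rewrite -subr_eq0 -mulrnBl => /eqP/L_tf/eqP; rewrite subr_eq0 => /eqP.
Qed.

Fact graph_lift_subproof x : (s x, x) \in approx_graph.
Proof. by apply/asboolP; exists 0; rewrite mul0rn addr0. Qed.
Definition graph_lift x := GraphMod (graph_lift_subproof x).

Fact graph_out_surj x : exists y, graph_out y = x.
Proof. by exists (graph_lift x). Qed.

Fact graph_exact y : graph_out y = 0 <-> exists z, graph_in z = y.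
Proof.
split=> [y0|[z <-]] //; case: y y0 => [[u v] uv]; rewrite /graph_out /= => v0.
have /asboolP[z /= uz] := uv; rewrite v0 in uz; have [w w0] := approx_end0.
exists (w + z); apply: val_inj; rewrite /= /graph_in_pair v0 uz w0.
by rewrite mulrnDl.
Qed.

Definition graph_extension := Extension graph_in_inj graph_out_surj graph_exact.

(** A splitting yields a retraction [rho] of the pullback onto L. Each x has a unique preimage in
    the kernel of [rho], and its first component, congruent to s x modulo p, serves as T x. *)
Lemma rigid_lift : rigid L ->
  exists2 T : L -> L, linear T & forall x, exists z, T x = s x + z *+ p.
Proof.
move=> /(_ graph_extension)[f [f_in f_out]].
pose rho y : L := (f y : L * L).1.
have rho_in z : rho (graph_in z) = z by rewrite /rho f_in.
have rhoL a x y : rho (a *: x + y) = a *: rho x + rho y.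
  by rewrite /rho linearP.
have kerP (y y' : graph_mod) : graph_out y = graph_out y' -> rho y = 0 -> rho y' = 0 -> y = y'.
  move=> yy' y0 y'0; have : graph_out (-1 *: y' + y) = 0.
    by rewrite linearP /= yy' scaleN1r addNr.
  move=> /graph_exact[z zE]; have : rho (-1 *: y' + y) = 0.
    by rewrite rhoL y0 y'0 scaler0 addr0.
  rewrite -zE rho_in => z0; move: zE; rewrite z0 linear0 scaleN1r addrC.
  by move=> /esym/eqP; rewrite subr_eq0 => /eqP.
have /choice[T TP] x : exists y : graph_mod, graph_out y = x /\ rho y = 0.
  (* Any preimage of x is moved into the kernel of [rho] by subtracting its retraction. *)
  exists (-1 *: graph_in (rho (graph_lift x)) + graph_lift x); split.
    by rewrite linearP /= scaleN1r oppr0 add0r.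
  by rewrite rhoL rho_in scaleN1r addNr.
exists (fun x => (val (T x)).1) => [a x y|x]; last first.
  have [Tx _] := TP x; case: (T x) Tx => u uG <-; exact/asboolP.
have -> : T (a *: x + y) = a *: T x + T y.
  have [TxD rxD] := TP (a *: x + y); have [Tx rx] := TP x; have [Ty ry] := TP y.
  by apply: kerP; rewrite // ?rhoL ?rx ?ry ?scaler0 ?addr0 // linearP /= Tx Ty.
by rewrite linearP.
Qed.
End ApproximateEndomorphisms.

(** * Lattices in coordinates *)

Section Lattices.
Variables (O : idomainType) (Lambda : algType O).
Implicit Types (L : lmodType Lambda^c) (x y : Lambda) (c : O).

Definition act L (u : L) x : L := (x : Lambda^c) *: u.

Lemma act1 L (u : L) : act u 1 = u.
Proof. exact: scale1r. Qed.

Lemma actM L (u : L) x y : act u (x * y) = act (act u x) y.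
Proof. by rewrite /act scalerA. Qed.

Lemma actDl L x : {morph (@act L)^~ x : u v / u + v}.
Proof. by move=> u v; exact: scalerDr. Qed.

Lemma actDr L (u : L) : {morph act u : x y / x + y}.
Proof. by move=> x y; exact: scalerDl. Qed.

Lemma act0 L x : act (0 : L) x = 0.
Proof. exact: scaler0. Qed.

Lemma actZr L (u : L) c x : act u (c *: x) = act (act u x) c%:A.
Proof. by rewrite -actM mulr_algr. Qed.

Lemma actZl L (u : L) c x : act u (c *: x) = act (act u c%:A) x.
Proof. by rewrite -actM mulr_algl. Qed.

(** Row vectors suit right modules: M is multiplicative in the order of Lambda. Compatibility with c
    in O is the case x = [c%:A] of [coord_act]. *)
Record coordinates L r (kappa : L -> 'rV[O]_r) (M : Lambda -> 'M[O]_r) := Coordinates {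
  coord_bij : bijective kappa;
  coordD : {morph kappa : u v / u + v};
  coord_act : forall u x, kappa (act u x) = kappa u *m M x;
  coord_rep : is_rep M
}.

Lemma lattice_coordinates L r : is_lattice_of_rank L r ->
  exists (kappa : L -> 'rV[O]_r) M, coordinates kappa M.
Proof.
move=> [e eP].
pose nu (v : 'rV[O]_r) : L := \sum_j act (e j) (v 0 j)%:A.
have nuD v w : nu (v + w) = nu v + nu w.
  by rewrite -big_split; apply: eq_bigr => j _; rewrite mxE scalerDl actDr.
have nuZ c v : nu (c *: v) = act (nu v) c%:A.
  rewrite /nu (big_morph _ (actDl c%:A) (act0 _ _)); apply: eq_bigr => j _.
  by rewrite mxE -actZr scalerA.
have /choice[kappa kappaK] u : exists v, nu v = u.
  have [c [cu _]] := eP u; exists (\row_j c j); rewrite cu.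
  by apply: eq_bigr => j _; rewrite mxE.
have nuI : injective nu.
  move=> v w vw; have [c [_ cP]] := eP (nu v).
  have coordE (z : 'rV_r) : nu v = nu z -> c = [ffun j => z 0 j].
    by move=> vz; apply: cP; rewrite vz; apply: eq_bigr => j _; rewrite ffunE.
  apply/rowP => j; have := coordE v erefl; rewrite (coordE w vw).
  by move/ffunP/(_ j); rewrite !ffunE.
have nuK : cancel nu kappa by move=> v; apply: nuI; rewrite kappaK.
have kD : {morph kappa : u v / u + v} by move=> u v; apply: nuI; rewrite nuD !kappaK.
have kZ u c : kappa (act u c%:A) = c *: kappa u.
  by apply: nuI; rewrite nuZ !kappaK.
have k0 : kappa 0 = 0.
  by apply: (addrI (kappa 0)); rewrite -kD !addr0.
pose M x := \matrix_i kappa (act (e i) x).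
have kM u x : kappa (act u x) = kappa u *m M x.
  rewrite -[u in LHS]kappaK /nu (big_morph _ (actDl x) (act0 _ _)).
  rewrite (big_morph kappa kD k0) mulmx_sum_row; apply: eq_bigr => j _.
  by rewrite rowK -actZl actZr kZ.
(* The action determines [M x], so the module axioms turn into those of a representation. *)
have MP x (N : 'M_r) : (forall u, kappa (act u x) = kappa u *m N) -> M x = N.
  by move=> xN; apply/row_matrixP => i; rewrite !rowE -(nuK (delta_mx 0 i)) -kM xN.
exists kappa, M; split=> //; first by exists nu.
split=> [|x y|c x y]; apply: MP => u.
- by rewrite act1 mulmx1.
- by rewrite actM !kM mulmxA.
by rewrite actDr kD actZr kZ !kM mulmxDr scalemxAr.
Qed.

Section Isomorphism.
Variables (L L' : lmodType Lambda^c) (r : nat).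
Variables (kappa : L -> 'rV[O]_r) (kappa' : L' -> 'rV[O]_r).
Variables (M M' : Lambda -> 'M[O]_r).
Hypotheses (kM : coordinates kappa M) (kM' : coordinates kappa' M').

Lemma coordinates_isomorphic (g : 'M_r) :
  g \in unitmx -> (forall x, M x *m g = g *m M' x) -> isomorphic L L'.
Proof.
move=> ug Mg; have [nu nuK kK] := coord_bij kM; have [nu' nuK' kK'] := coord_bij kM'.
pose f u := nu' (kappa u *m g); have kf u : kappa' (f u) = kappa u *m g by rewrite kK'.
have linf : linear f.
  move=> x u v; apply: (can_inj nuK'); rewrite (coordD kM') kf (coordD kM) mulmxDl.
  rewrite -!kf; congr (_ + _); rewrite kf -[x *: u]/(act u x) (coord_act kM).
  by rewrite -mulmxA Mg mulmxA -kf -(coord_act kM').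
exists (HB.pack_for {linear L -> L'} f (GRing.isLinear.Build Lambda^c L L' *:%R f linf)).
exists (fun v => nu (kappa' v *m invmx g)) => u /=.
  by rewrite kf mulmxK ?nuK.
by apply: (can_inj nuK'); rewrite kf kK mulmxKV.
Qed.
End Isomorphism.

Section RigidLattices.
Variables (k : fieldType) (res : {rmorphism O -> k}) (p : nat).
Hypotheses (res_surj : forall c : k, exists b, res b = c)
  (res_eq0 : forall c, res c = 0 -> exists b, c = b *+ p)
  (res_p : res p%:R = 0) (p_neq0 : (p%:R : O) != 0).
Local Notation red := (map_mx res).

Lemma red_eq0 m n (N : 'M[O]_(m, n)) : red N = 0 -> exists N', N = N' *+ p.
Proof.
move=> N0; have /choice[f fE] ij : exists b, N ij.1 ij.2 = b *+ p.
  by apply: res_eq0; have /matrixP/(_ ij.1 ij.2) := N0; rewrite !mxE.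
exists (\matrix_(i, j) f (i, j)); apply/matrixP => i j.
by rewrite mulmxnE mxE -fE.
Qed.

Variables (L : lmodType Lambda^c) (r : nat).
Variables (kappa : L -> 'rV[O]_r) (M : Lambda -> 'M[O]_r).
Hypothesis kM : coordinates kappa M.

(** Any lift S' of S commutes with the action up to multiples of p, so it defines an approximate
    endomorphism, to which [rigid_lift] applies. *)
Lemma rigid_liftable (S : 'M[k]_r) : rigid L ->
  (forall x, red (M x) *m S = S *m red (M x)) ->
  exists2 T, red T = S & forall x, M x *m T = T *m M x.
Proof.
move=> rigL MS; have [S' S'S] := red_surj res_surj S.
have [nu nuK kK] := coord_bij kM; have kI := can_inj nuK.
have kD := coordD kM; have kA := coord_act kM.
have k0 : kappa 0 = 0 by apply: (addrI (kappa 0)); rewrite -kD !addr0.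
have kMn u n : kappa (u *+ n) = kappa u *+ n.
  by elim: n => [|n IHn]; rewrite ?mulr0n // !mulrS kD IHn.
pose s u := nu (kappa u *m S').
have sE u : kappa (s u) = kappa u *m S' by rewrite kK.
have sP (x : Lambda^c) u v : exists z, s (x *: u + v) = x *: s u + s v + z *+ p.
  have [|N NE] := @red_eq0 _ _ (M x *m S' - S' *m M x).
    by rewrite map_mxB !map_mxM S'S MS subrr.
  exists (nu (kappa u *m N)); apply: kI.
  rewrite !(kD, kMn, sE, kK) -[x *: u]/(act u x) -[x *: s u]/(act (s u) x) !kA sE.
  rewrite mulmxDl -!mulmxA addrAC; congr (_ + _).
  by rewrite -(raddfMn (mulmx (kappa u))) -mulmxDr -NE addrC subrK.
have L_tf (u : L) : u *+ p = 0 -> u = 0.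
  move=> up0; have := kMn u p; rewrite up0 k0 => u0; apply: kI; rewrite k0.
  apply/rowP => j; have /rowP/(_ j)/esym/eqP := u0.
  by rewrite mulmxnE -mulr_natl mxE mulf_eq0 (negPf p_neq0) => /eqP ->.
have [T linT TP] := @rigid_lift _ L p (ApproxEnd sP) L_tf rigL.
have TA u x : T (act u x) = act (T u) x.
  have := linT x u 0; have := linT 1 0 0.
  rewrite !scale1r !addr0 => T0.
  have {}T0 : T 0 = 0 by apply: (addrI (T 0)); rewrite addr0 -T0.
  by rewrite T0 addr0.
have TD u v : T (u + v) = T u + T v by have := linT 1 u v; rewrite !scale1r.
have T0 : T 0 = 0 by apply: (addrI (T 0)); rewrite -TD !addr0.
pose Tm := \matrix_i kappa (T (nu (delta_mx 0 i))).
have MA c : M c%:A = c%:M := repA (coord_rep kM) c.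
(* T is O-linear because O acts through Lambda, so it is given by a matrix. *)
have kT u : kappa (T u) = kappa u *m Tm.
  have uE : u = \sum_j act (nu (delta_mx 0 j)) (kappa u 0 j)%:A.
    apply: kI; rewrite (big_morph kappa kD k0) {1}[kappa u]row_sum_delta.
    by apply: eq_bigr => j _; rewrite kA kK MA mul_mx_scalar.
  rewrite {1}uE (big_morph T TD T0) (big_morph kappa kD k0) mulmx_sum_row.
  by apply: eq_bigr => j _; rewrite rowK TA kA MA mul_mx_scalar.
exists Tm.
  apply/row_matrixP => i; rewrite !rowE; have [z Tz] := TP (nu (delta_mx 0 i)).
  have /(congr1 red) : delta_mx 0 i *m Tm = delta_mx 0 i *m S' + kappa z *+ p.
    by rewrite -{1}(kK (delta_mx 0 i)) -kT Tz /= kD kMn sE kK.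
  rewrite map_mxD !map_mxM S'S map_delta_mx => ->.
  by rewrite -scaler_nat map_mxZ res_p scale0r addr0.
move=> x; apply/row_matrixP => i; rewrite !rowE -(kK (delta_mx 0 i)) !mulmxA.
by rewrite -kA -!kT -kA TA.
Qed.
End RigidLattices.
End Lattices.

(** * Finiteness for one rational type and the conclusion *)

Section RigidClasses.
Variables (O : idomainType) (Lambda : algType O).
Variables (k : fieldType) (res : {rmorphism O -> k}) (p : nat).
Hypotheses (res_surj : forall c : k, exists b, res b = c)
  (res_unit : forall b : O, res b != 0 -> b \is a GRing.unit)
  (res_eq0 : forall b : O, res b = 0 -> exists b', b = b' *+ p)
  (res_p : res p%:R = 0) (p_neq0 : (p%:R : O) != 0).
Variables (d : nat) (e : 'I_d -> Lambda).
Hypothesis eP : free_basis (fun (c : O) x => c *: x) e.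

(** Passes from the basis e, on which [local_rep_bound] works, to all of Lambda; it serves for f the
    reduction and f the identity. *)
Lemma rep_commute (R : comNzRingType) (f : {rmorphism O -> R}) r (M M' : Lambda -> 'M[O]_r)
    (S : 'M[R]_r) :
  is_rep M -> is_rep M' ->
  (forall l, map_mx f (M (e l)) *m S = S *m map_mx f (M' (e l))) ->
  forall x, map_mx f (M x) *m S = S *m map_mx f (M' x).
Proof.
move=> repM repM' MS x; have [c [-> _]] := eP x.
apply: (big_ind (fun x => map_mx f (M x) *m S = S *m map_mx f (M' x))).
- by rewrite (rep0 repM) (rep0 repM') map_mx0 mul0mx mulmx0.
- move=> u v Mu Mv; rewrite (repD repM) (repD repM') !map_mxD mulmxDl mulmxDr.
  by rewrite Mu Mv.
by move=> l _; rewrite (repZ repM) (repZ repM') !map_mxZ -scalemxAl MS scalemxAr.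
Qed.

Lemma rational_type_classes s (J : 'I_s -> Lambda -> Prop)
    (JD : forall t c x y, J t x -> J t y -> J t (c *: x + y))
    (JM : forall t x y, J t x -> J t (x * y))
    (Jmin : forall t x y, J t x -> x != 0 -> J t y ->
       exists2 c, c != 0 & exists z, c *: y = x * z)
    (J1 : exists2 c, c != 0 & exists2 x : 'I_s -> Lambda,
       (forall t, J t (x t)) & c%:A = \sum_t x t)
    r (T : {set 'I_r * 'I_s}) :
  finitely_many_isoclasses (fun L : lmodType Lambda^c => rigid L /\
    exists (kappa : L -> 'rV[O]_r) M, coordinates kappa M /\ rational_type J M T).
Proof.
apply: finitely_many_bounded.
have [D maxD] := local_rep_bound res_surj res_unit d r; exists D => m X XP nX.
have /choice[M MP] i : exists M, exists2 kappa : X i -> 'rV[O]_r,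
    coordinates kappa M & rational_type J M T.
  by have [_ [kappa [M [kM typM]]]] := XP i; exists M, kappa.
have repM i : is_rep (M i) by have [kappa kM _] := MP i; exact: coord_rep kM.
(* The three conditions follow from rigidity, from the common rational type and from
   non-isomorphism. *)
apply: (maxD m (fun i l => M i (e l))) => [i S MS|i j|i j g ij ug Mg].
- have [kappa kM _] := MP i; have [rigX _] := XP i.
  have [|T' T'S MT'] := rigid_liftable res_surj res_eq0 res_p p_neq0 kM rigX (S := S).
    exact: rep_commute MS.
  by exists T'.
- have [_ _ typi] := MP i; have [_ _ typj] := MP j.
  have [g g0 Mg] := rational_type_generic JD JM Jmin J1 (repM i) (repM j) typi typj.
  by exists g.
have [kappa kM _] := MP i; have [kappa' kM' _] := MP j.
apply: (nX i j ij); apply: (coordinates_isomorphic kM kM' ug) => x.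
have Mg' l : map_mx idfun (M i (e l)) *m g = g *m map_mx idfun (M j (e l)).
  by rewrite !map_mx_id.
by have := rep_commute (repM i) (repM j) Mg' x; rewrite !map_mx_id.
Qed.
End RigidClasses.

Theorem theoremA (p : nat) (k : closedFieldType) (kp : p \in [pchar k])
    (Lambda : algType (Witt kp)) (A : falgType {fraction (Witt kp)})
    (iota : {rmorphism Lambda -> A})
    (HLambda : is_order iota) (HA : separable_algebra A) (n : nat) :
  finitely_many_isoclasses (fun L : lmodType Lambda^c =>
    (exists r : nat, (r <= n)%N /\ is_lattice_of_rank L r) /\ rigid L).
Proof.
have [s [J [JD JM Jmin J1]]] := order_right_ideals HLambda (separable_semisimple HA).
have [_ _ [d [e eP]] _] := HLambda.
(* A color is a rank r <= n with a candidate rational type, a subset of a finite set; hence there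
   are finitely many. *)
pose color := {r : 'I_n.+1 & {set 'I_r * 'I_s}}.
apply: (@finitely_many_cover _ color (fun c L => rigid L /\
  exists (kappa : L -> 'rV[Witt kp]_(tag c)) M,
    coordinates kappa M /\ rational_type J M (tagged c))) => [c|L [[r [le_rn latL]] rigL]].
  apply: (rational_type_classes (res := @witt_res p k kp) (p := p) _ _ _ _ _ eP JD JM Jmin J1).
  - exact: witt_res_surj.
  - exact: witt_unit_res.
  - exact: witt_res_eq0.
  - by rewrite rmorph_nat (pcharf0 kp).
  - exact: witt_pchar0.
have [kappa [M kM]] := lattice_coordinates latL.
have [T typT] := rational_type_ex J M.
have lt_rn : (r < n.+1)%N by [].
exists (Tagged (fun r : 'I_n.+1 => {set 'I_r * 'I_s}) (T : {set 'I_(Ordinal lt_rn) * 'I_s})).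
by split=> //; exists kappa, M.
Qed.
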